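(* Let $(E,\|\cdot\|)$ be a separable complex Banach space. Then the grassmanian $\mathcal G_{w*}(E^* )$ of weak-$*$ closed vector subspaces of the dual $E^*$ is a Polish space for the Vietoris topology.
   Context: For a compact Hausdorff space $X$, the Vietoris topology on the set $\mathcal F(X)$ of closed subsets of $X$ is generated by the sets $\{F: F\cap U\neq\emptyset\}$ and $\{F: F\subseteq U\}$ for $U\subseteq X$ open. The closed unit ball $(E^* )_1$ of $E^*$ (for the dual norm) is compact Hausdorff for the weak-$*$ topology. A subspace $W\in\mathcal G_{w*}(E^* )$ is identified with its closed unit ball $(W)_1=W\cap (E^* )_1\in\mathcal F((E^* )_1)$, and the Vietoris topology on $\mathcal G_{w*}(E^* )$ is the topology induced by the Vietoris topology of $\mathcal F((E^* )_1)$. A Polish space is a separable topological space whose topology admits a compatible complete metric. *)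

(* Defs.v *)
From HB Require Import structures.
From mathcomp Require Import all_boot all_order all_algebra.
From mathcomp Require Import complex.
From mathcomp Require Import all_classical all_reals all_analysis.

Set Implicit Arguments.
Unset Strict Implicit.
Unset Printing Implicit Defensive.

Import Order.TTheory GRing.Theory Num.Theory.
Import numFieldNormedType.Exports.

Local Open Scope classical_set_scope.
Local Open Scope ring_scope.

Definition separable (T : topologicalType) : Prop :=
  exists2 D : set T, countable D & dense D.

Definition is_metric (R : realType) (T : Type) (d : T -> T -> R) : Prop :=
  [/\ forall x y, 0 <= d x y,
      forall x y, d x y = 0 <-> x = y,
      forall x y, d x y = d y x &
      forall x y z, d x z <= d x y + d y z].

Definition compatible_metric (R : realType) (T : topologicalType)
    (d : T -> T -> R) : Prop :=
  forall A : set T, open A <->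
    forall x, A x -> exists2 e : R, 0 < e & [set y | d x y < e] `<=` A.

Definition complete_metric (R : realType) (T : topologicalType)
    (d : T -> T -> R) : Prop :=
  forall u : nat -> T,
    (forall e : R, 0 < e ->
       exists N, forall m n, (N <= m)%N -> (N <= n)%N -> d (u m) (u n) < e) ->
    exists x : T, forall e : R, 0 < e ->
      exists N, forall n, (N <= n)%N -> d (u n) x < e.

Definition polish (R : realType) (T : topologicalType) : Prop :=
  separable T /\
  exists d : T -> T -> R,
    [/\ is_metric d, compatible_metric d & complete_metric d].

Section Vietoris.
Variable X : topologicalType.

Definition closed_subsets : Type := set_type [set F : set X | closed F].

HB.instance Definition _ := Choice.on closed_subsets.

(* The subbasic sets are indexed by pairs (b, U) with U open: hitting U for
   b = true, being included in U for b = false. *)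
Definition vietoris_subbase (i : bool * set X) : set closed_subsets :=
  if i.1 then [set F | \val F `&` i.2 !=set0] else [set F | \val F `<=` i.2].

HB.instance Definition _ := @isSubBaseTopological.Build closed_subsets
  (bool * set X)%type [set i | open i.2] vietoris_subbase.

End Vietoris.

Section Dual.
Variables (R : realType) (E : normedModType R[i]).

Definition dual_pred : {pred (E -> R[i]^o)} :=
  fun f => `[< linear f /\ continuous f >].

Lemma dual_submod_closed : submod_closed dual_pred.
Proof.
split.
  apply/asboolP; split; first by move=> a x y /=; rewrite scaler0 addr0.
  by move=> x; exact: cvg_cst.
move=> a f g /asboolP[lf cf] /asboolP[lg cg]; apply/asboolP; split.
  move=> b x y; rewrite !fctE lf lg !scalerDr !scalerA (mulrC a b).
  by rewrite -!addrA; congr (_ + _); rewrite addrCA.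
by move=> x; apply: cvgD; [apply: cvgZr; exact: cf|exact: cg].
Qed.

HB.instance Definition _ :=
  GRing.isSubmodClosed.Build R[i] (E -> R[i]^o) dual_pred dual_submod_closed.

Definition dual : Type := {f : E -> R[i]^o | f \in dual_pred}.

HB.instance Definition _ := [isSub of dual for @sval _ _].
HB.instance Definition _ := [Choice of dual by <:].
HB.instance Definition _ := [SubChoice_isSubLmodule of dual by <:].

(* The topology carried by [dual] is the weak-* topology, i.e. the one induced
   by pointwise convergence on E, not the norm topology. *)
HB.instance Definition _ := Topological.copy dual
  (initial_topology (fun f : dual => (\val f : {ptws E -> R[i]^o}))).

(* The norms `|x| and `|\val f x| are elements of R[i] with zero imaginary
   part. *)
Definition dual_norm (f : dual) : R :=
  sup [set complex.Re `|\val f x| | x in [set x : E | `|x| <= 1]].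

Definition dual_ball : set dual := [set f | dual_norm f <= 1].

Definition grassmannian : Type :=
  set_type [set W : set dual | submod_closed [in W] /\ closed W].

HB.instance Definition _ := Choice.on grassmannian.

Lemma closed_unit_ball_of (W : grassmannian) :
  closed ((set_val : dual_ball -> dual) @^-1` \val W).
Proof.
have [_ cW] := set_mem (svalP W).
by apply: closed_comp => // x _; exact: initial_continuous.
Qed.

(* The closed unit ball of W, as a closed subset of the space [dual_ball]. *)
Definition unit_ball_of (W : grassmannian) : closed_subsets dual_ball :=
  exist _ ((set_val : dual_ball -> dual) @^-1` \val W)
    (mem_set (@closed_unit_ball_of W)).

HB.instance Definition _ :=
  Topological.copy grassmannian (initial_topology unit_ball_of).

End Dual.

(* Main.v *)
From HB Require Import structures.
Require Import Defs.
From mathcomp Require Import finmap.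
From mathcomp Require Import all_boot all_order all_algebra.
From mathcomp Require Import complex.
From mathcomp Require Import all_classical all_reals all_analysis.
From mathcomp Require Import ring lra.

Set Implicit Arguments.
Unset Strict Implicit.
Unset Printing Implicit Defensive.

Import Order.TTheory GRing.Theory Num.Theory.
Import numFieldNormedType.Exports.

Local Open Scope classical_set_scope.
Local Open Scope ring_scope.

(** A weak-* closed subspace [W] of the dual of [E] is encoded by the seminorm
    [wnorm W x], the supremum of [|f x|] over the unit ball of [W]. By the
    Hahn-Banach theorem this is the distance from [x] to the closed subspace [V]
    of [E] on which [W] vanishes, and [V] determines [W] by the bipolar theorem.
    Thus the Grassmannian is embedded into the space of functions on [E], and,
    since these functions are 1-Lipschitz, into a countable product of real
    lines through their values on a dense sequence [q] of [E].

    The embedding is topological: the Vietoris topology is the topology of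
    pointwise convergence of the seminorms. The unit ball of [W'] is contained
    in an open set as soon as [wnorm W'] is small at finitely many points of [V]
    ([miss_of_wnorm], by compactness of the dual ball), and it meets a
    neighbourhood of an element [f] of the ball of [W] as soon as [wnorm W'] is
    close to [wnorm W] on a compact set of combinations of finitely many vectors
    ([hit_of_wnorm], where [f] is moved into [W'] by extending it from a
    graph).

    The image is a G_delta in its closure. A pointwise limit [P] of such
    seminorms is a seminorm bounded by the norm; it comes from a subspace iff it
    is the distance to its kernel. As [E] is complete, it suffices for this
    that every [x] has, for every [e], a point [y] with [|x - y| < P x + e] and
    [P y < e] ([seminorm_exact_zero], by successive corrections). With [x] and
    [y] taken in [q] and [e] of the form [1 / k.+1], this is a countable family
    of open conditions on [P]. A G_delta subset of a countable product of real
    lines is Polish ([polish_of_Gdelta_image]). *)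

(** * Metrics on countable products of real lines *)

Section ProductMetric.
Variables (R : realType) (I : countType) (i0 : I).
Implicit Types (p q r : I -> R) (i : I).

Let w i : R := ((pickle i).+1%:R)^-1.

Let w_gt0 i : 0 < w i.
Proof. by rewrite /w invr_gt0 ltr0n. Qed.

Definition pdist p q : R := sup (range (fun i => Num.min (w i) `|p i - q i|)).

Let pdist_has_sup p q : has_sup (range (fun i => Num.min (w i) `|p i - q i|)).
Proof.
split; first by exists (Num.min (w i0) `|p i0 - q i0|), i0.
exists 1 => _ [i _ <-]; rewrite ge_min invf_le1 ?ltr0n // ler1n.
by [].
Qed.

Lemma pdist_ub p q i : Num.min (w i) `|p i - q i| <= pdist p q.
Proof. by apply: sup_ubound; [case: (pdist_has_sup p q)|exists i]. Qed.

Lemma pdist_le p q e :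
  (forall i, Num.min (w i) `|p i - q i| <= e) -> pdist p q <= e.
Proof.
move=> h; apply: ge_sup; first by case: (pdist_has_sup p q).
by move=> _ [i _ <-].
Qed.

Lemma pdist_ge0 p q : 0 <= pdist p q.
Proof. by apply: le_trans (pdist_ub p q i0); rewrite le_min ltW //=. Qed.

Lemma pdistC p q : pdist p q = pdist q p.
Proof. by rewrite /pdist; under eq_fun do rewrite distrC. Qed.

Lemma pdist_eq0 p q : pdist p q = 0 <-> forall i, p i = q i.
Proof.
split=> [pq i|pq].
  have := pdist_ub p q i; rewrite pq ge_min leNgt w_gt0 /= normr_le0 subr_eq0.
  by move/eqP.
apply/le_anti; rewrite pdist_ge0 andbT; apply: pdist_le => i.
by rewrite pq subrr normr0 ge_min lexx orbT.
Qed.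

Lemma pdist_triangle q p r : pdist p r <= pdist p q + pdist q r.
Proof.
apply: pdist_le => i.
apply: le_trans (lerD (pdist_ub p q i) (pdist_ub q r i)).
have := ler_distD (q i) (p i) (r i); have := w_gt0 i.
have := normr_ge0 (p i - q i); have := normr_ge0 (q i - r i).
by case: (leP (w i) `|p i - q i|); case: (leP (w i) `|q i - r i|);
  case: (leP (w i) `|p i - r i|); lra.
Qed.

Lemma pdist_coord i e : 0 < e ->
  exists2 d, 0 < d & forall p q, pdist p q < d -> `|p i - q i| < e.
Proof.
move=> e0; exists (Num.min (w i) e); first by rewrite lt_min w_gt0.
move=> p q; rewrite lt_min => /andP[pw pe].
have := pdist_ub p q i; rewrite ge_min leNgt (le_lt_trans _ pw) //=.
by move=> /le_lt_trans; apply.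
Qed.

(** Only the finitely many coordinates whose weight exceeds [e / 2] matter. *)
Lemma pdist_small e : 0 < e -> exists s : seq I, exists2 d, 0 < d &
  forall p q, (forall i, i \in s -> `|p i - q i| < d) -> pdist p q < e.
Proof.
move=> e0; pose N := (Num.truncn (2 / e)).+1.
exists (pmap unpickle (iota 0 N)); exists (e / 2); first by rewrite divr_gt0.
move=> p q h; apply: (@le_lt_trans _ _ (e / 2)); last by lra.
apply: pdist_le => i; rewrite ge_min; case: (ltnP (pickle i) N) => iN.
  apply/orP; right; apply/ltW/h; rewrite mem_pmap; apply/mapP.
  by exists (pickle i); rewrite ?mem_iota ?pickleK.
apply/orP; left; rewrite /w -[e / 2]invrK lef_pV2 ?posrE ?invr_gt0 ?divr_gt0 //.
rewrite invfM invrK mulrC; apply/ltW/(lt_le_trans (truncnS_gt _)).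
by rewrite ler_nat -/N ltnW.
Qed.

End ProductMetric.

(** * Subsets of countable products that are Polish *)

Section CompatibleMetric.
Variables (R : realType) (X : topologicalType) (d : X -> X -> R).
Hypothesis dxx : forall x, d x x = 0.
Hypothesis dtri : forall y x z, d x z <= d x y + d y z.

Lemma compatible_metricP : compatible_metric d <->
  forall x (A : set X),
    nbhs x A <-> exists2 e : R, 0 < e & [set y | d x y < e] `<=` A.
Proof.
split=> [cd x A|nd A]; last first.
  by rewrite openE; split=> h x /h /nd.
split=> [|[e e0 eA]].
  rewrite nbhsE => -[B [oB Bx] BA].
  have [e e0 eB] := (cd B).1 oB x Bx.
  by exists e => // y /eB /BA.
rewrite nbhsE; exists [set y | d x y < e] => //; split; last by rewrite /= dxx.
apply/cd => y /= xy; exists (e - d x y); first by rewrite subr_gt0.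
move=> z /=; rewrite ltrBrDl; exact/le_lt_trans/dtri.
Qed.

End CompatibleMetric.

Lemma near_seq (T : Type) (I : eqType) (F : set_system T) (s : seq I)
    (P : I -> T -> Prop) : Filter F ->
  (forall i, i \in s -> \forall y \near F, P i y) ->
  \forall y \near F, forall i, i \in s -> P i y.
Proof.
move=> FF; elim: s => [|i s IH] h; first by apply: nearW.
have h1 := h i (mem_head _ _).
have h2 : \forall y \near F, forall j, j \in s -> P j y.
  by apply: IH => j js; apply: h; rewrite inE js orbT.
apply: filterS2 h1 h2 => y Pi Ps j; rewrite inE => /orP[/eqP->//|]; exact: Ps.
Qed.

Section Polish.
Variables (R : realType) (X : topologicalType) (I : countType) (i0 : I).
Variable phi : X -> I -> R.
Let d x y := pdist (phi x) (phi y).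
Hypothesis phi_inj : forall x y, (forall i, phi x i = phi y i) -> x = y.
Hypothesis phi_compat : compatible_metric d.

Let phi_metric : is_metric d.
Proof.
split=> [x y|x y|x y|x y z]; [exact: pdist_ge0| |exact: pdistC|].
- by split=> [/(pdist_eq0 i0)/phi_inj //|->]; exact/(pdist_eq0 i0).
- exact: pdist_triangle.
Qed.

Lemma coordinates_nbhs x A :
  nbhs x A <-> exists2 e : R, 0 < e & [set y | d x y < e] `<=` A.
Proof.
have [_ d0 _ dt] := phi_metric.
by apply: (compatible_metricP _ _).1 => // y; exact/d0.
Qed.

Lemma coordinates_continuous i : continuous (phi^~ i : X -> R).
Proof.
move=> x; apply/cvgrPdist_lt => e e0; apply/coordinates_nbhs.
have [a a0 h] := pdist_coord i0 i e0.
by exists a => // y /= /h.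
Qed.

(** Round all coordinates down to multiples of [1 / n]: a finite record of
    roundings is an element of a countable type, and one point is chosen for
    every record that occurs. *)
Let coordinates_separable : separable X.
Proof.
pose P (t : nat * seq int) x := forall j, (j < size t.2)%N ->
  forall i, unpickle j = Some i ->
  Num.floor (t.1%:R * phi x i) = nth 0 t.2 j.
pose S t : set X := if pselect (exists x, P t x) is left h
  then [set projT1 (cid h)] else set0.
exists (\bigcup_(t in setT) S t).
  apply: bigcup_countable => // t _; rewrite /S; case: pselect => h.
    exact: countable1.
  exact: countable0.
move=> A [x Ax] oA.
have [e e0 eA] := (phi_compat A).1 oA x Ax.
have [s [a a0 small]] := @pdist_small R I i0 _ e0.
pose n := (Num.truncn (a^-1)).+1.
have na : n%:R^-1 < a.
  by rewrite -[ltRHS]invrK ltf_pV2 ?posrE ?ltr0n ?invr_gt0// truncnS_gt.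
pose N := (\max_(i <- s) (pickle i).+1)%N.
pose q := [seq (if unpickle j is Some i then Num.floor (n%:R * phi x i) else 0)
  | j <- iota 0 N].
have Pex : exists y, P (n, q) y.
  exists x => j /=; rewrite size_map size_iota => jN i ji.
  by rewrite (nth_map 0%N) ?size_iota// nth_iota// ji.
have : S (n, q) (projT1 (cid Pex)).
  rewrite /S; case: pselect => [h|/(_ Pex)//].
  by rewrite (Prop_irrelevance h Pex).
case: (cid Pex) => y /= Py Sy; exists y; split; last by exists (n, q).
apply: eA => /=; apply: small => i si.
have iN : (pickle i < N)%N.
  by rewrite /N; apply: leq_trans (leq_bigmax_seq _ si _).
have := Py (pickle i); rewrite /= size_map size_iota => /(_ iN i (pickleK _)).
rewrite (nth_map 0%N) ?size_iota// nth_iota// pickleK => yx.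
apply: lt_trans na; rewrite -(@ltr_pM2l _ n%:R) ?ltr0n// divff ?pnatr_eq0//.
rewrite -[X in X * _]ger0_norm// -normrM mulrBr.
have := Num.Theory.floor_le (n%:R * phi x i); have := Num.Theory.floorD1_gt (n%:R * phi x i).
have := Num.Theory.floor_le (n%:R * phi y i); have := Num.Theory.floorD1_gt (n%:R * phi y i).
rewrite yx intrD; set f := (_%:~R : R) => *; rewrite ltr_norml; apply/andP; split; lra.
Qed.

(** The limit of a Cauchy sequence exists coordinatewise, and a closed image
    contains it. *)
Lemma polish_of_closed_image :
  (forall p : I -> R, (forall e : R, 0 < e -> exists x, pdist (phi x) p < e) ->
     exists x, forall i, phi x i = p i) ->
  polish R X.
Proof.
move=> closed_phi; split; first exact: coordinates_separable.
exists d; split=> // u cau.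
have cvu i : cvg ((fun n => phi (u n) i : R) @ \oo).
  apply/cauchy_cvgP/cauchy_ballP => e e0; rewrite near_simpl.
  have [a a0 ha] := pdist_coord i0 i e0.
  have [N hN] := cau _ a0.
  exists ([set n | (N <= n)%N], [set n | (N <= n)%N]).
    by split; exists N.
  by move=> [m n] [/= Nm Nn]; apply: ha; exact: hN.
pose p i := lim ((fun n => phi (u n) i : R) @ \oo).
have pu e : 0 < e -> exists N, forall n, (N <= n)%N -> pdist (phi (u n)) p < e.
  move=> e0; have [s [a a0 small]] := @pdist_small R I i0 _ e0.
  have : \forall n \near \oo, forall i, i \in s -> `|phi (u n) i - p i| < a.
    by apply: near_seq => i _; by have /cvgrPdistC_lt/(_ _ a0) := cvu i.
  by move=> [N _ hN]; exists N => n Nn; apply: small; exact: hN.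
have [x xp] := closed_phi p (fun e e0 =>
  let: ex_intro N hN := pu e e0 in ex_intro _ (u N) (hN N (leqnn N))).
have phixp : phi x = p by apply/funext.
by exists x => e /pu[N hN]; exists N => n /hN; rewrite /d phixp.
Qed.

End Polish.

Section PolishGdelta.
Variables (R : realType) (X : topologicalType) (I K : countType) (i0 : I).
Variable phi : X -> I -> R.
Let d x y := pdist (phi x) (phi y).
Hypothesis phi_inj : forall x y, (forall i, phi x i = phi y i) -> x = y.
Hypothesis phi_compat : compatible_metric d.
Variable G : K -> set (I -> R).
Hypothesis openG : forall k p, G k p ->
  exists2 e : R, 0 < e & forall q, pdist p q < e -> G k q.
Hypothesis phiG : forall x k, G k (phi x).

Let depth_set k p : set R :=
  [set r | [/\ 0 <= r, r <= 1 & forall q, pdist p q < r -> G k q]].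

(** The distance of a point to the complement of an open set, truncated at 1
    so as to be finite when that complement is empty. *)
Let depth k p : R := sup (depth_set k p).

Let depth_has_sup k p : has_sup (depth_set k p).
Proof.
split; last by exists 1 => r [].
exists 0; split=> // q.
by rewrite ltNge (pdist_ge0 i0).
Qed.

Let depth_ub k p r : depth_set k p r -> r <= depth k p.
Proof. by apply: sup_ubound; case: (depth_has_sup k p). Qed.

Let depth_ge0 k p : 0 <= depth k p.
Proof.
by apply: depth_ub; split=> // q; rewrite ltNge (pdist_ge0 i0).
Qed.

Let depth_gt0 k p : G k p -> 0 < depth k p.
Proof.
move=> /openG[e e0 eG].
have m0 : 0 < Num.min e 1 by rewrite lt_min e0 ltr01.
apply: (lt_le_trans m0); apply: depth_ub; split; first exact: ltW.
  by rewrite ge_min lexx orbT.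
by move=> q; rewrite lt_min => /andP[/eG].
Qed.

Let depth_in k p q : pdist p q < depth k p -> G k q.
Proof.
move=> pq; have := sup_gt (proj1 (depth_has_sup k p)) pq.
by move=> [r [_ _ h] /h].
Qed.

Let depth_lipschitz k p q : depth k p <= depth k q + pdist p q.
Proof.
apply: ge_sup; first by case: (depth_has_sup k p).
move=> r [r0 r1 rG]; rewrite -lerBlDr.
have [h|/ltW h] := leP 0 (r - pdist p q); last exact: le_trans h (depth_ge0 _ _).
apply: depth_ub; split=> //.
  by rewrite lerBlDr (le_trans r1)// lerDl (pdist_ge0 i0).
move=> q'; rewrite ltrBrDl => h'; apply: rG.
exact: le_lt_trans (pdist_triangle i0 q p q') h'.
Qed.

Let psi x (j : I + K) : R :=
  match j with inl i => phi x i | inr k => (depth k (phi x))^-1 end.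

Let psi_continuous j : continuous (psi^~ j : X -> R).
Proof.
case: j => [i|k] x; first exact: (coordinates_continuous i0 phi_inj phi_compat).
apply: cvgV; first by rewrite gt_eqF ?depth_gt0.
apply/cvgrPdist_lt => e e0; apply/(coordinates_nbhs i0 phi_inj phi_compat); exists e => // y xy.
have := depth_lipschitz k (phi x) (phi y).
have := depth_lipschitz k (phi y) (phi x).
rewrite (pdistC (phi y)) ltr_norml; move: xy; rewrite /= => xy h1 h2.
by apply/andP; split; lra.
Qed.

(** Alexandrov's remetrization: adding to the coordinates the inverses of the
    distances to the complements of the [G k] makes the image closed, since a
    limit on the boundary of some [G k] would have an infinite coordinate. *)
Lemma polish_of_Gdelta_image :
  (forall p : I -> R, (forall e : R, 0 < e -> exists x, pdist (phi x) p < e) ->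
     (forall k, G k p) -> exists x, forall i, phi x i = p i) ->
  polish R X.
Proof.
move=> closed_phi; pose j0 : I + K := inl i0.
apply: (@polish_of_closed_image _ _ _ j0 psi).
- by move=> x y xy; apply: phi_inj => i; exact: (xy (inl i)).
- apply/compatible_metricP.
  + by move=> x; apply/(pdist_eq0 j0).
  + by move=> y x z; exact: (pdist_triangle j0).
  move=> x A; split.
    move=> /(coordinates_nbhs i0 phi_inj phi_compat)[e e0 eA].
    have [s [a a0 small]] := @pdist_small R I i0 _ e0.
    have h : \forall b \near 0^'+, forall i, i \in s -> forall p q : I + K -> R,
        pdist p q < b -> `|p (inl i) - q (inl i)| < a.
      apply: near_seq => i _; have [b b0 hb] := pdist_coord j0 (inl i) a0.
      near=> c => p q pq; apply: hb; apply: (lt_le_trans pq).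
      by near: c; exact: nbhs_right_le.
    near (0 : R)^'+ => b.
    exists b => // y /= xy; apply: eA => /=; apply: small => i si.
    have hb : forall i, i \in s -> forall p q : I + K -> R,
        pdist p q < b -> `|p (inl i) - q (inl i)| < a by near: b.
    exact: (hb i si _ _ xy).
  move=> [e e0 eA].
  have [s [a a0 small]] := @pdist_small R (I + K)%type j0 _ e0.
  have : \forall y \near x, forall j, j \in s -> `|psi x j - psi y j| < a.
    by apply: near_seq => j _; have /cvgrPdist_lt/(_ _ a0) := @psi_continuous j x.
  by apply: filterS => y /small/eA.
move=> p' clp'; pose p i := p' (inl i).
have clp (t : seq K) e : 0 < e -> exists x, pdist (phi x) p < e /\
    forall k, k \in t -> `|(depth k (phi x))^-1 - p' (inr k)| < e.
  move=> e0; have [s [a a0 small]] := @pdist_small R I i0 _ e0.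
  have : \forall b \near (0 : R)^'+, forall j,
     j \in map inl s ++ map inr t -> forall q r : I + K -> R,
        pdist q r < b -> `|q j - r j| < Num.min a e.
    apply: near_seq => j _.
    have m0 : 0 < Num.min a e by rewrite lt_min a0.
    have [b b0 hb] := pdist_coord j0 j m0.
    near=> c => q r qr; apply: hb; apply: (lt_le_trans qr).
    by near: c; exact: nbhs_right_le.
  move=> h; near (0 : R)^'+ => b.
  have hb : forall j,
     j \in map inl s ++ map inr t -> forall q r : I + K -> R,
        pdist q r < b -> `|q j - r j| < Num.min a e by near: b.
  have b0 : 0 < b by [].
  have [x xp] := clp' _ b0; exists x; split.
    apply: small => i si; have := hb (inl i) _ _ _ xp.
    by rewrite mem_cat map_f// lt_min => /(_ isT)/andP[].
  move=> k kt; have := hb (inr k) _ _ _ xp.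
  by rewrite mem_cat [X in _ || X]map_f// orbT lt_min => /(_ isT)/andP[].
have Gp k : G k p.
  have c0 : 0 < (`|p' (inr k)| + 1)^-1 by rewrite invr_gt0 ltr_wpDl.
  have m0 : 0 < Num.min 1 (`|p' (inr k)| + 1)^-1 by rewrite lt_min ltr01.
  have [x []] := clp [:: k] _ m0.
  rewrite lt_min => /andP[_ xp] /(_ k (mem_head _ _)); rewrite lt_min => /andP[+ _].
  have D0 := depth_gt0 (phiG x k) => dk.
  apply: (@depth_in k (phi x)); apply: (lt_le_trans xp).
  rewrite -[leRHS]invrK lef_pV2 ?posrE ?invr_gt0// ?ltr_wpDl//.
  have := ler_norm (p' (inr k)); move: dk; rewrite ltr_norml => /andP[_ dk].
  lra.
have [x xp] := closed_phi p (fun e e0 =>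
  let: ex_intro x (conj h _) := clp [::] e e0 in ex_intro _ x h) Gp.
exists x; case=> [i|k]; first exact: xp.
have phixp : phi x = p by apply/funext.
apply/eqP; rewrite -subr_eq0 -normr_le0; apply/ler_addgt0Pl => e e0; rewrite addr0.
have e2 : 0 < e / 2 by rewrite divr_gt0.
have := @psi_continuous (inr k) x => /cvgrPdist_lt/(_ _ e2).
move=> /(coordinates_nbhs i0 phi_inj phi_compat)[b b0 hb].
have m0 : 0 < Num.min b (e / 2) by rewrite lt_min b0.
have [y []] := clp [:: k] _ m0.
rewrite lt_min => /andP[yp _] /(_ k (mem_head _ _)); rewrite lt_min => /andP[_ yk].
have := hb y; rewrite /= /d phixp pdistC => /(_ yp) xy.
apply: (le_trans (ler_distD (depth k (phi y))^-1 _ _)).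
lra.
Unshelve. all: by end_near. Qed.

End PolishGdelta.

(** * Real-valued norms and the Hahn-Banach theorem *)

Section RealNorm.
Variables (R : realType) (V : normedModType R[i]).
Implicit Types (x y : V) (a : R[i]).

(** The norm of a complex normed space takes its values in [R[i]]; its real
    part carries the same information in an order that has suprema. *)
Definition rnorm x : R := complex.Re `|x|.

Lemma rnormE x : `|x| = real_complex R (rnorm x).
Proof. by rewrite /rnorm RRe_real// ger0_real. Qed.

Lemma rnorm_ge0 x : 0 <= rnorm x.
Proof. by rewrite -lecR -rnormE normr_ge0. Qed.

Lemma rnorm0 : rnorm 0 = 0.
Proof. by rewrite /rnorm normr0. Qed.

Lemma rnorm_eq0 x : rnorm x = 0 -> x = 0.
Proof. by move=> h; apply/eqP; rewrite -normr_eq0 rnormE h. Qed.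

Lemma rnormD x y : rnorm (x + y) <= rnorm x + rnorm y.
Proof. by rewrite -lecR rmorphD/= -!rnormE ler_normD. Qed.

Lemma rnorm_sum n (F : 'I_n -> V) : rnorm (\sum_i F i) <= \sum_i rnorm (F i).
Proof.
elim/big_ind2 : _ => [|x1 r1 x2 r2 h1 h2|//]; first by rewrite rnorm0.
exact: le_trans (rnormD _ _) (lerD h1 h2).
Qed.

Lemma rnormN x : rnorm (- x) = rnorm x.
Proof. by rewrite /rnorm normrN. Qed.

Lemma rnormB x y : rnorm (x - y) = rnorm (y - x).
Proof. by rewrite /rnorm distrC. Qed.

Lemma rnorm_nbhs x (A : set V) :
  nbhs x A <-> exists2 e : R, 0 < e & forall y, rnorm (x - y) < e -> A y.
Proof.
split=> [/nbhs_ballP[e e0 eA]|[e e0 eA]]; last first.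
  apply/nbhs_ballP; exists (real_complex R e); first by rewrite /= ltcR.
  move=> y; rewrite -ball_normE /= => xy; apply: eA.
  by rewrite -ltcR -rnormE.
exists (complex.Re e).
  by move: e0; rewrite /= ltcE => /andP[].
move=> y xy; apply: eA; rewrite -ball_normE /= rnormE.
by rewrite -(RRe_real (gtr0_real e0)) ltcR.
Qed.

End RealNorm.

Section ComplexModulus.
Variable R : realType.
Local Notation C := (R[i]^o).
Implicit Types (z w : C) (r : R).

Lemma rnormZ (V : normedModType R[i]) (a : C) (x : V) :
  rnorm ((a : R[i]) *: x) = rnorm a * rnorm x.
Proof. by apply: complexI; rewrite rmorphM/= -!rnormE normrZ. Qed.

Lemma rnorm_real r : rnorm (real_complex R r : C) = `|r|.
Proof. by rewrite /rnorm normc_def /= expr0n addr0 sqrtr_sqr. Qed.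

Lemma Re_le_rnorm z : complex.Re z <= rnorm z.
Proof.
rewrite /rnorm normc_def /=; apply: le_trans (ler_norm _) _.
by rewrite -sqrtr_sqr ler_wsqrtr// lerDl sqr_ge0.
Qed.

Lemma phase z : exists2 a : C, rnorm a = 1 & (a : R[i]) * z = real_complex R (rnorm z).
Proof.
have [->|z0] := eqVneq z 0.
  by exists 1; rewrite ?mulr0 ?rnorm0// /rnorm normr1.
have n0 : `|z| != 0 by rewrite normr_eq0.
exists (`|z| / z : R[i]).
  by rewrite /rnorm normrM normfV normr_id mulfV.
by rewrite divfK// rnormE.
Qed.

End ComplexModulus.

Section HahnBanach.
Variables (R : realType) (L : lmodType R[i]) (P : L -> R).
Hypothesis PD : forall x y, P (x + y) <= P x + P y.
Hypothesis PZ : forall (a : R[i]^o) x, P ((a : R[i]) *: x) = rnorm a * P x.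

(** Partially defined real-linear functionals are represented by their graphs,
    so that the union of a chain needs no gluing. *)
Let real_graph (A : set (L * R)) :=
  (forall u v (t : R), A u -> A v ->
     A (u.1 + real_complex R t *: v.1, u.2 + t * v.2)) /\
  (forall u, A u -> u.2 <= P u.1).

Let real_graph0 A u : real_graph A -> A u -> A (0, 0).
Proof.
move=> [lA _] Au; have := lA u u (-1) Au Au.
by rewrite rmorphN1 scaleN1r subrr mulN1r subrr.
Qed.

Let real_graphZ A u (t : R) : real_graph A -> A u ->
  A (real_complex R t *: u.1, t * u.2).
Proof.
move=> gA Au; have := gA.1 _ _ t (real_graph0 gA Au) Au.
by rewrite /= !add0r.
Qed.

Let PZr (t : R) x : 0 <= t -> P (real_complex R t *: x) = t * P x.
Proof. by move=> t0; rewrite PZ rnorm_real ger0_norm. Qed.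

Let real_extend1 A z : real_graph A -> A (0, 0) ->
  exists B, [/\ real_graph B, A `<=` B & exists r, B (z, r)].
Proof.
move=> gA A0; pose S := [set u.2 - P (u.1 - z) | u in A].
have Sub u v : A u -> A v -> u.2 - P (u.1 - z) <= P (v.1 + z) - v.2.
  move=> Au Av; rewrite lerBlDr -addrAC lerBrDr.
  have /= := gA.2 _ (gA.1 _ _ 1 Au Av); rewrite rmorph1 scale1r mul1r => h.
  apply: (le_trans h); rewrite addrC.
  by apply: le_trans (PD _ _); rewrite addrACA addNr addr0.
(* any value between the bounds that [Sub] separates can be given to [z] *)
pose c := sup S.
have cub u : A u -> u.2 - P (u.1 - z) <= c.
  move=> Au; apply: sup_ubound; last by exists u.
  by exists (P (0 + z) - 0) => _ [v Av <-]; exact: (Sub _ (0, 0)).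
have clb v : A v -> c <= P (v.1 + z) - v.2.
  move=> Av; apply: ge_sup; first by exists (0 - P (0 - z)), (0, 0).
  by move=> _ [u Au <-]; exact: Sub.
exists [set w | exists u (t : R),
  A u /\ w = (u.1 + real_complex R t *: z, u.2 + t * c)].
split; [split| |].
- move=> _ _ t [u [a [Au ->]]] [v [b [Av ->]]] /=.
  exists (u.1 + real_complex R t *: v.1, u.2 + t * v.2), (a + t * b).
  split; first exact: gA.1.
  congr (_, _) => /=; last by lra.
  rewrite scalerDr rmorphD rmorphM scalerDl scalerA.
  by rewrite addrACA.
- move=> _ [u [t [Au ->]]] /=.
  have [t0|t0|<-] := ltgtP 0 t; last first.
  + by rewrite rmorph0 scale0r mul0r !addr0; exact: gA.2.
  + have s0 : 0 < - t by rewrite oppr_gt0.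
    have := cub _ (real_graphZ (- t)^-1 gA Au) => /=.
    rewrite -(ler_pM2l s0) mulrBr -PZr ?(ltW s0)// scalerBr scalerA -rmorphM.
    rewrite mulrA mulfV ?gt_eqF// rmorph1 scale1r mul1r rmorphN scaleNr opprK.
    by lra.
  + have := clb _ (real_graphZ t^-1 gA Au) => /=.
    rewrite -(ler_pM2l t0) mulrBr -PZr ?(ltW t0)// scalerDr scalerA -rmorphM.
    rewrite mulrA mulfV ?gt_eqF// rmorph1 scale1r mul1r.
    by lra.
- move=> u Au; exists u, 0; split=> //.
  by rewrite rmorph0 scale0r mul0r !addr0 -surjective_pairing.
- by exists c, (0, 0), 1; split=> //; rewrite rmorph1 scale1r mul1r !add0r.
Qed.

Let real_hahn_banach (A : set (L * R)) : real_graph A -> A (0, 0) ->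
  exists f : L -> R, [/\ forall (t : R) x y,
      f (x + real_complex R t *: y) = f x + t * f y,
    forall x, f x <= P x & forall u, A u -> f u.1 = u.2].
Proof.
move=> gA A0.
(* the empty graph is admitted, as the union of the empty chain *)
have [B [[gB AB] Bmax]] : exists B,
    (real_graph B /\ (B !=set0 -> A `<=` B)) /\
    forall B', B `<` B' -> ~ (real_graph B' /\ (B' !=set0 -> A `<=` B')).
  apply: (Zorn_bigcup (P := fun B => real_graph B /\ (B !=set0 -> A `<=` B))).
  move=> F FP Ftot; split; [split|].
  - move=> u v t [X FX Xu] [Y FY Yv].
    have [XY|YX] := Ftot _ _ FX FY.
      by exists Y => //; apply: (FP _ FY).1.1 => //; exact: XY.
    by exists X => //; apply: (FP _ FX).1.1 => //; exact: YX.
  - by move=> u [X FX Xu]; exact: (FP _ FX).1.2.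
  - move=> [u [X FX Xu]] v Av; exists X => //.
    by apply: (FP _ FX).2 => //; exists u.
have Bn : B !=set0.
  apply: contrapT => /nonemptyPn B0; apply: (Bmax A); last by split=> // _; exact: subset_refl.
  by split; [rewrite B0; exact: sub0set|rewrite B0 => /(_ _ A0)].
have {}AB := AB Bn; have B0 := AB _ A0.
have Btot z : exists r, B (z, r).
  have [B' [gB' BB' [r B'zr]]] := real_extend1 z gB B0.
  exists r; apply: contrapT => nB; apply: (Bmax B').
    by split=> // /(_ _ B'zr).
  by split=> // _; exact: subset_trans BB'.
have Bfun z r s : B (z, r) -> B (z, s) -> r = s.
  have P0 : P 0 = 0 by rewrite -(scale0r 0) (PZ 0) rnorm0 mul0r.
  have le r' s' : B (z, r') -> B (z, s') -> r' <= s'.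
    move=> Br Bs; have := gB.2 _ (gB.1 _ _ (-1) Br Bs) => /=.
    by rewrite rmorphN1 scaleN1r subrr P0 mulN1r subr_le0.
  by move=> Br Bs; apply/le_anti; rewrite !le.
pose f z := projT1 (cid (Btot z)).
have Bf z : B (z, f z) by rewrite /f; case: cid.
exists f; split.
- by move=> t x y; apply: (Bfun _ _ _ (Bf _)); exact: (gB.1 (x, f x) (y, f y)).
- by move=> x; exact: (gB.2 _ (Bf x)).
- by move=> [x r] /AB Bu; exact: (Bfun _ _ _ (Bf x)).
Qed.

(** A complex functional is determined by its real part [f], as
    [f x - i f (i x)], and a phase turns a bound on the real part into a bound
    on the modulus; so the real theorem applies to the real parts. *)
Theorem hahn_banach (G : set (L * R[i]^o)) :
    G (0, 0) ->
    (forall u v (a : R[i]), G u -> G v ->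
       G (u.1 + a *: v.1, u.2 + a *: v.2)) ->
    (forall u, G u -> rnorm u.2 <= P u.1) ->
  exists g : L -> R[i]^o, [/\ linear g, forall x, rnorm (g x) <= P x &
    forall u, G u -> g u.1 = u.2].
Proof.
move=> G0 Glin GP.
pose A : set (L * R) := [set u | exists2 r, G (u.1, r) & u.2 = complex.Re r].
have [||f [flin fP fA]] := @real_hahn_banach A.
- split=> [u v t [r Gr ->] [s Gs ->] /=|u [r Gr ->]]; last first.
    exact: le_trans (Re_le_rnorm _) (GP _ Gr).
  exists (r + real_complex R t *: s).
    exact: (Glin (u.1, r) (v.1, s) (real_complex R t)).
  by case: r s {Gr Gs} => [a b] [c d] /=; rewrite mul0r subr0.
- by exists 0.
have f0 : f 0 = 0.
  by apply: (fA (0, 0)); exists 0.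
have fD x y : f (x + y) = f x + f y.
  by have := flin 1 x y; rewrite rmorph1 scale1r mul1r.
have fZ (t : R) x : f (real_complex R t *: x) = t * f x.
  by have := flin t 0 x; rewrite f0 !add0r.
pose i : R[i] := Complex 0 1.
pose g x : R[i]^o := Complex (f x) (- f (i *: x)).
have glin : linear g.
  move=> a x y; rewrite /g.
  have fa z : f (a *: z) = complex.Re a * f z + complex.Im a * f (i *: z).
    have aE : a = real_complex R (complex.Re a) + real_complex R (complex.Im a) * i.
      by rewrite mulrC -complexE.
    by rewrite [in LHS]aE scalerDl fD fZ -scalerA fZ.
  have -> : i *: (a *: x + y) = a *: (i *: x) + i *: y.
    by rewrite scalerDr !scalerA mulrC.
  rewrite !fD !fa scalerA (_ : i * i = -1); last by rewrite -expr2 sqr_i.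
  have fN z : f (-1 *: z) = - f z.
    by have := fZ (-1) z; rewrite rmorphN1 mulN1r.
  rewrite fN; case: a {fa} => a b; apply/eqP; rewrite eq_complex /=.
  by apply/andP; split; apply/eqP; lra.
exists g; split=> //.
- move=> x; have [a a1 ag] := phase (g x).
  have : g ((a : R[i]) *: x) = a *: g x.
    have g0 : g 0 = 0 by rewrite /g scaler0 f0 oppr0.
    by have := glin a x 0; rewrite g0 !addr0.
  rewrite [RHS]ag => /(congr1 (@complex.Re R)) /= <-.
  by apply: (le_trans (fP _)); rewrite PZ a1 mul1r.
- move=> [x r] Gxr; rewrite /g /=.
  have -> : f x = complex.Re r by apply: (fA (x, _)); exists r.
  have -> : f (i *: x) = complex.Re (i * r).
    apply: (fA (i *: x, _)); exists (i * r) => //.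
    by have := Glin _ _ i G0 Gxr; rewrite /= !add0r.
  by case: r {Gxr} => a b /=; rewrite mul0r mul1r sub0r opprK.
Qed.

End HahnBanach.

(** * The dual space and its unit ball *)

Section DualSpace.
Variables (R : realType) (E : normedModType R[i]).
Local Notation C := (R[i]^o).
Implicit Types (f g : dual E) (x y : E) (a : R[i]).

Lemma dual_linear f : linear (\val f).
Proof. by have /asboolP[] := valP f. Qed.

Lemma dual_continuous f : continuous (\val f : E -> C).
Proof. by have /asboolP[] := valP f. Qed.

Lemma dual_app0 f : \val f 0 = 0.
Proof.
have := dual_linear f 1 0 0; rewrite !scale1r addr0.
by move=> /(congr1 (fun z => z - \val f 0)); rewrite addrK subrr.
Qed.

Lemma dual_appD f x y : \val f (x + y) = \val f x + \val f y.
Proof. by have := dual_linear f 1 x y; rewrite !scale1r. Qed.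

Lemma dual_appZ f a x : \val f (a *: x) = a *: \val f x.
Proof. by have := dual_linear f a x 0; rewrite dual_app0 !addr0. Qed.

Lemma dual_appB f x y : \val f (x - y) = \val f x - \val f y.
Proof. by rewrite -scaleN1r dual_appD dual_appZ scaleN1r. Qed.

Lemma dualD_app f g x : \val (f + g) x = \val f x + \val g x.
Proof. by []. Qed.

Lemma dualZ_app a f x : \val (a *: f) x = a *: \val f x.
Proof. by []. Qed.

Lemma linear_dual (g : E -> C) (M : R) : linear g ->
  (forall x, rnorm (g x) <= M * rnorm x) -> exists f : dual E, \val f = g.
Proof.
move=> lg gM.
have gc : continuous g.
  move=> x A /rnorm_nbhs[e e0 eA]; apply/rnorm_nbhs.
  exists (e / (`|M| + 1)); first by rewrite divr_gt0 // ltr_wpDl.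
  move=> y xy; apply: eA.
  have -> : g x - g y = g (x - y).
    by rewrite addrC -scaleN1r -lg scaleN1r addrC.
  apply: (le_lt_trans (gM _)); move: xy; rewrite ltr_pdivlMr ?ltr_wpDl//.
  apply: le_lt_trans; rewrite mulrC ler_wpM2l ?rnorm_ge0//.
  by rewrite (le_trans (ler_norm _))// lerDl.
have gd : g \in @dual_pred R E by apply/asboolP.
by exists (exist _ g gd).
Qed.

Lemma dual_bounded f :
  exists2 M : R, 0 < M & forall x, rnorm (\val f x) <= M * rnorm x.
Proof.
have : nbhs (\val f 0) [set z : C | rnorm z < 1].
  apply/rnorm_nbhs; exists 1 => // z; rewrite dual_app0 sub0r rnormN.
  by [].
move=> /(@dual_continuous f 0)/rnorm_nbhs[d d0 fd].
exists (2 / d) => [|x]; first by rewrite divr_gt0.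
have [x0|x0] := eqVneq (rnorm x) 0.
  by rewrite x0 (rnorm_eq0 x0) dual_app0 rnorm0 mulr0.
have {}x0 : 0 < rnorm x by rewrite lt_neqAle eq_sym x0 rnorm_ge0.
pose t := d / (2 * rnorm x).
have t0 : 0 < t by rewrite divr_gt0// mulr_gt0.
have := fd (real_complex R t *: x); rewrite sub0r rnormN rnormZ rnorm_real.
rewrite gtr0_norm// (_ : t * rnorm x = d / 2); last by rewrite /t; field; rewrite gt_eqF.
rewrite /= dual_appZ rnormZ rnorm_real gtr0_norm// => h.
have {}h : t * rnorm (\val f x) < 1 by apply: h; lra.
rewrite -(ler_pM2l t0) (_ : t * (2 / d * rnorm x) = 1) ?ltW//.
by rewrite /t; field; rewrite !gt_eqF.
Qed.

(** Continuity makes [f] bounded on the unit ball, so that the supremum in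
    [dual_norm] is not the default value of an unbounded set. *)
Lemma dual_ballP f : dual_ball f <-> forall x, rnorm (\val f x) <= rnorm x.
Proof.
have [M M0 fM] := dual_bounded f; rewrite /dual_ball /dual_norm /=.
set S := [set _ | _ in _].
have le1 x : `|x| <= 1 = (rnorm x <= 1) by rewrite rnormE (lecR _ 1).
split=> [f1 x|h]; last first.
  apply: ge_sup; first by exists (rnorm (\val f 0)), 0; rewrite //= normr0.
  by move=> _ [x /= x1 <-]; apply: (le_trans (h x)); rewrite -le1.
have [x0|x0] := eqVneq (rnorm x) 0.
  by rewrite x0 (rnorm_eq0 x0) dual_app0 rnorm0.
have {}x0 : 0 < rnorm x by rewrite lt_neqAle eq_sym x0 rnorm_ge0.
have : rnorm (\val f (real_complex R (rnorm x)^-1 *: x)) <= 1.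
  apply: le_trans f1; apply: sup_ubound.
    exists M => _ [y /= y1 <-]; apply: (le_trans (fM y)).
    by rewrite ler_piMr ?(ltW M0)// -le1.
  exists (real_complex R (rnorm x)^-1 *: x) => //=.
  by rewrite le1 rnormZ rnorm_real ger0_norm ?invr_ge0 ?rnorm_ge0// mulVf ?gt_eqF.
rewrite dual_appZ rnormZ rnorm_real ger0_norm ?invr_ge0 ?rnorm_ge0//.
by rewrite ler_pdivrMl// mulr1.
Qed.

Lemma dual_evaluation_continuous x : continuous (fun f => \val f x : C).
Proof.
move=> f A; move: (@initial_continuous _ _
  (fun f : dual E => (\val f : {ptws E -> C})) f) => h hA.
exact: (h _ (@proj_continuous E (fun=> C) x (\val f) A hA)).
Qed.

(** The sets given by finitely many values form a filter that converges
    pointwise to [f], hence is finer than the neighbourhood filter. *)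
Lemma dual_nbhs f (A : set (dual E)) :
  nbhs f A -> exists s : seq E, exists2 e : R, 0 < e &
    forall g, (forall x, x \in s -> rnorm (\val f x - \val g x) < e) -> A g.
Proof.
pose D := [set u : seq E * R | 0 < u.2].
pose B (u : seq E * R) := [set h : E -> C |
  forall x, x \in u.1 -> rnorm (\val f x - h x) < u.2].
pose F := filter_from D B.
have FF : Filter F.
  apply: filter_from_filter; first by exists ([::], 1); rewrite /D /=.
  move=> [s d] [t e] d0 e0; exists (s ++ t, Num.min d e).
    by rewrite /D /= lt_min d0.
  move=> h /= hst; split=> x /= xs.
    by have := hst x; rewrite mem_cat xs lt_min => /(_ isT)/andP[].
  by have := hst x; rewrite mem_cat xs orbT lt_min => /(_ isT)/andP[].
have : {ptws, F --> \val f}.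
  apply/pointwise_cvgP.
  move=> x V /rnorm_nbhs[e e0 eV]; exists ([:: x], e) => // h hx; apply: eV.
  by apply: hx; rewrite mem_head.
move=> Ff [_ [[U oU <-] Uf UA]].
have /Ff[[s e] e0 sU] : nbhs (\val f : {ptws E -> C}) U.
  exact: open_nbhs_nbhs.
by exists s, e => // g gs; apply: UA; exact: sU.
Qed.

End DualSpace.

(** * Weak-* closed subspaces and their seminorms *)

Lemma scaleCE (R : realType) (a : R[i]) (z : R[i]^o) : a *: z = a * z.
Proof. by []. Qed.

Section Bipolar.
Variables (R : realType) (E : normedModType R[i]).
Implicit Types (f g : dual E) (x y : E) (S : set (dual E)).

Definition preannihilator S : set E := [set x | forall g, S g -> \val g x = 0].

(** Induction on [s], for all subspaces at once: if some [u] in [S] takes the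
    value 1 at the first point [y], the remaining points are treated in the
    hyperplane [S1] of those elements of [S] that vanish at [y]; a point [x] is
    annihilated by [S1] iff [x - u(x) y] is annihilated by [S]. *)
Lemma subspace_interpolation (s : seq E) S f : submod_closed [in S] ->
    (forall x, preannihilator S x -> \val f x = 0) ->
  exists2 g, S g & forall y, y \in s -> \val g y = \val f y.
Proof.
elim: s S f => [|y s IH] S f [S0 SD] fS.
  by exists 0 => //; exact: set_mem.
have Slin a g h : S g -> S h -> S (a *: g + h).
  by move=> Sg Sh; apply/set_mem; apply: SD; exact/mem_set.
have {}S0 : S 0 by exact: set_mem.
have [yS|/existsNP[v /not_implyP[Sv vy]]] := pselect (preannihilator S y).
  have [g Sg gs] := IH S f (conj (mem_set S0) SD) fS.
  exists g => // z; rewrite inE => /orP[/eqP->|/gs//].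
  by rewrite fS// yS.
pose u : dual E := (\val v y)^-1 *: v.
have Su : S u by rewrite -[u]addr0; exact: Slin.
have uy : \val u y = 1 by rewrite dualZ_app scaleCE mulVf//; exact/eqP.
pose S1 : set (dual E) := [set g | S g /\ \val g y = 0].
have S1c : submod_closed [in S1].
  split; first by apply/mem_set; split.
  move=> a g h /set_mem[Sg gy] /set_mem[Sh hy]; apply/mem_set; split.
    exact: Slin.
  by rewrite dualD_app dualZ_app gy hy scaler0 addr0.
pose f1 : dual E := (- \val f y) *: u + f.
have f1E x : \val f1 x = \val f x - \val f y * \val u x.
  by rewrite dualD_app dualZ_app addrC scaleCE mulNr.
have [|g [Sg gy] gs] := IH S1 f1 S1c.
  move=> x xS1; rewrite f1E.
  have : preannihilator S (x - \val u x *: y).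
    move=> g Sg; pose g1 : dual E := (- \val g y) *: u + g.
    have := xS1 g1; rewrite dualD_app dualZ_app dual_appB dual_appZ.
    rewrite scaleCE mulNr addrC mulrC; apply; split; first exact: Slin.
    by rewrite dualD_app dualZ_app uy scaleCE mulr1 addNr.
  by move=> /fS; rewrite dual_appB dual_appZ scaleCE mulrC.
exists (\val f y *: u + g); first exact: Slin.
move=> z; rewrite dualD_app dualZ_app scaleCE inE => /orP[/eqP->|/gs->].
  by rewrite uy gy mulr1 addr0.
by rewrite f1E addrC subrK.
Qed.

(** A weak-* neighbourhood constrains finitely many values, and those can be
    interpolated within the subspace. *)
Lemma bipolar S f : submod_closed [in S] -> closed S ->
  (forall x, preannihilator S x -> \val f x = 0) -> S f.
Proof.
move=> Sc clS fS; apply: clS => A /dual_nbhs[s [e e0 sA]].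
have [g Sg gs] := subspace_interpolation s Sc fS.
exists g; split=> //; apply: sA => x xs.
by rewrite gs// subrr rnorm0.
Qed.

End Bipolar.

Section SubspaceNorm.
Variables (R : realType) (E : normedModType R[i]).
Implicit Types (W : grassmannian E) (f g : dual E) (x y : E).

Lemma grassmannian_submod W : submod_closed [in \val W].
Proof. by case: (set_mem (svalP W)). Qed.

Lemma grassmannian_closed W : closed (\val W).
Proof. by case: (set_mem (svalP W)). Qed.

Lemma grassmannian0 W : \val W 0.
Proof. by have [/set_mem] := grassmannian_submod W. Qed.

Lemma grassmannianZ W a f : \val W f -> \val W (a *: f).
Proof.
move=> Wf; rewrite -[_ *: f]addr0; apply: set_mem.
by apply: (grassmannian_submod W).2; apply: mem_set => //; exact: grassmannian0.
Qed.

Lemma dual_ball0 : dual_ball (0 : dual E).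
Proof. by apply/dual_ballP => x; rewrite rnorm0 rnorm_ge0. Qed.

(** By duality this is the distance from [x] to the preannihilator of [W], so
    that these seminorms record the quotient norms by the closed subspaces of
    [E]. *)
Definition wnorm W x : R :=
  sup [set rnorm (\val f x) | f in \val W `&` dual_ball (E:=E)].

Let wnorm_has_sup W x :
  has_sup [set rnorm (\val f x) | f in \val W `&` dual_ball (E:=E)].
Proof.
split.
  exists (rnorm (\val (0 : dual E) x)), 0 => //; split.
    exact: grassmannian0.
  exact: dual_ball0.
by exists (rnorm x) => _ [f [_ /dual_ballP fB] <-].
Qed.

Lemma wnorm_ub W x f : \val W f -> dual_ball f -> rnorm (\val f x) <= wnorm W x.
Proof.
by move=> Wf Bf; apply: sup_ubound; [case: (wnorm_has_sup W x)|exists f].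
Qed.

Lemma wnorm_le W x (c : R) :
  (forall f, \val W f -> dual_ball f -> rnorm (\val f x) <= c) -> wnorm W x <= c.
Proof.
move=> h; apply: ge_sup; first by case: (wnorm_has_sup W x).
by move=> _ [f [Wf Bf] <-]; exact: h.
Qed.

Lemma wnorm_gt W x (c : R) : c < wnorm W x ->
  exists f, [/\ \val W f, dual_ball f & c < rnorm (\val f x)].
Proof.
move=> /(sup_gt (proj1 (wnorm_has_sup W x)))[_ [f [Wf Bf] <-] cf].
by exists f.
Qed.

Lemma wnorm_ge0 W x : 0 <= wnorm W x.
Proof.
by have := wnorm_ub x (grassmannian0 W) dual_ball0; apply: le_trans; rewrite rnorm_ge0.
Qed.

Lemma wnorm_le_rnorm W x : wnorm W x <= rnorm x.
Proof. by apply: wnorm_le => f _ /dual_ballP. Qed.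

Lemma wnormD W x y : wnorm W (x + y) <= wnorm W x + wnorm W y.
Proof.
apply: wnorm_le => f Wf Bf; rewrite dual_appD.
by apply: (le_trans (rnormD _ _)); rewrite lerD ?wnorm_ub.
Qed.

Lemma wnormZ W (a : R[i]^o) x : wnorm W ((a : R[i]) *: x) = rnorm a * wnorm W x.
Proof.
have le b y : wnorm W ((b : R[i]) *: y) <= rnorm (b : R[i]^o) * wnorm W y.
  apply: wnorm_le => f Wf Bf; rewrite dual_appZ rnormZ.
  by rewrite ler_wpM2l ?rnorm_ge0 ?wnorm_ub.
have [->|a0] := eqVneq a 0.
  by apply/le_anti; rewrite le rnorm0 mul0r wnorm_ge0.
apply/le_anti; rewrite le /=.
have n0 : 0 < rnorm a.
  by rewrite lt_neqAle rnorm_ge0 andbT; apply/contra_neq: a0 => /esym/rnorm_eq0.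
rewrite -ler_pdivlMl//; apply: le_trans (_ : _ <= wnorm W (a^-1 *: (a *: x))) _.
  by rewrite scalerA mulVf// scale1r.
apply: (le_trans (le _ _)).
by rewrite {1}/rnorm normfV rnormE -fmorphV.
Qed.

Lemma wnorm_lipschitz W x y : wnorm W x <= wnorm W y + rnorm (x - y).
Proof.
rewrite -{1}[x](subrK y) addrC; apply: (le_trans (wnormD _ _ _)).
by rewrite lerD2l wnorm_le_rnorm.
Qed.

Lemma wnorm_dist W x y : `|wnorm W x - wnorm W y| <= rnorm (x - y).
Proof.
have := wnorm_lipschitz W x y; have := wnorm_lipschitz W y x.
by rewrite (rnormB y) ler_norml => *; apply/andP; split; lra.
Qed.

Lemma wnorm_eq0 W x : wnorm W x = 0 <-> preannihilator (\val W) x.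
Proof.
split=> [x0 f Wf|xW]; last first.
  apply/le_anti; rewrite wnorm_ge0 andbT; apply: wnorm_le => f Wf _.
  by rewrite xW// rnorm0.
have [M M0 fM] := dual_bounded f.
have Wg : \val W (real_complex R M^-1 *: f) by exact: grassmannianZ.
have Bg : dual_ball (real_complex R M^-1 *: f).
  apply/dual_ballP => y; rewrite dualZ_app rnormZ rnorm_real.
  by rewrite ger0_norm ?invr_ge0 ?(ltW M0)// ler_pdivrMl.
have := wnorm_ub x Wg Bg; rewrite x0 dualZ_app rnormZ rnorm_real.
rewrite pmulr_rle0 ?normr_gt0 ?invr_eq0 ?gt_eqF// => h.
by apply: rnorm_eq0; apply/le_anti; rewrite h rnorm_ge0.
Qed.

Lemma grassmannian_of_le_wnorm W f :
  (forall x, rnorm (\val f x) <= wnorm W x) -> \val W f.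
Proof.
move=> fW; apply: bipolar; [exact: grassmannian_submod|exact: grassmannian_closed|].
move=> x /wnorm_eq0 x0; apply: rnorm_eq0; apply/le_anti.
by rewrite rnorm_ge0 andbT -x0.
Qed.

Lemma wnorm_inj W W' : (forall x, wnorm W x = wnorm W' x) -> W = W'.
Proof.
have sub V V' : (forall x, wnorm V x = wnorm V' x) -> \val V `<=` \val V'.
  move=> VV' f Vf; apply: bipolar; [exact: grassmannian_submod|exact: grassmannian_closed|].
  by move=> x /wnorm_eq0; rewrite -VV' => /wnorm_eq0; exact.
by move=> WW'; apply: val_inj; apply/seteqP; split; exact: sub.
Qed.

(** The distance from [x] to the preannihilator of [W] is at most [wnorm W x].
    Were it at least [c = wnorm W x + e], the functional [a x + y |-> a c] would
    be bounded by the norm, and its extension to [E] would be an element of the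
    ball of [W] that exceeds [wnorm W x] at [x]. *)
Lemma wnorm_approx W x (e : R) : 0 < e ->
  exists y, wnorm W y = 0 /\ rnorm (x - y) < wnorm W x + e.
Proof.
move=> e0; apply: contrapT => noy.
pose c := wnorm W x + e.
have c0 : 0 < c by rewrite ltr_wpDl ?wnorm_ge0.
have far y : wnorm W y = 0 -> c <= rnorm (x - y).
  by move=> y0; rewrite leNgt; apply/negP => yc; apply: noy; exists y.
pose G : set (E * R[i]^o) := [set u | exists a y, wnorm W y = 0 /\
  u = (a *: x + y, a * real_complex R c : R[i])].
have null a y z : wnorm W y = 0 -> wnorm W z = 0 -> wnorm W (y + a *: z) = 0.
  move=> y0 z0; apply/le_anti; rewrite wnorm_ge0 andbT.
  by apply: (le_trans (wnormD _ _ _)); rewrite wnormZ y0 z0 mulr0 addr0.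
have n0 : wnorm W 0 = 0 by rewrite -(scale0r 0) (wnormZ W 0) rnorm0 mul0r.
have [|||g [glin gB gG]] := hahn_banach (@rnormD R E) (@rnormZ R E) (G := G).
- by exists 0, 0; rewrite scale0r addr0 mul0r.
- move=> _ _ b [a [y [y0 ->]]] [a' [y' [y'0 ->]]].
  exists (a + b * a'), (y + b *: y'); split; first exact: null.
  congr (_, _) => /=; last by rewrite scaleCE mulrDl mulrA.
  by rewrite scalerDl scalerDr scalerA addrACA.
- move=> _ [a [y [y0 ->]]] /=; have [->|a0] := eqVneq a 0.
    by rewrite mul0r rnorm0 rnorm_ge0.
  have -> : a *: x + y = a *: (x - (0 + - a^-1 *: y)).
    by rewrite add0r scaleNr opprK scalerDr scalerA mulfV// scale1r.
  rewrite !rnormZ rnorm_real gtr0_norm// ler_wpM2l ?rnorm_ge0//.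
  by apply: far; exact: null.
have [f fg] := @linear_dual _ _ g 1 glin (fun x =>
  eq_ind_r (fun r => rnorm (g x) <= r) (gB x) (mul1r _)).
have Bf : dual_ball f by apply/dual_ballP; rewrite fg.
have Wf : \val W f.
  apply: bipolar; [exact: grassmannian_submod|exact: grassmannian_closed|].
  move=> y /wnorm_eq0 y0; rewrite fg; apply: (gG (y, 0)); exists 0, y.
  by rewrite scale0r add0r mul0r.
have := wnorm_ub x Wf Bf; rewrite fg (gG (x, real_complex R c)); last first.
  by exists 1, 0; rewrite scale1r addr0 mul1r.
by rewrite rnorm_real gtr0_norm// /c; lra.
Qed.

End SubspaceNorm.

(** * Weak-* compactness of the dual ball *)

(** The disc is closed in the image of a square. *)
Lemma compact_disc (R : realType) (r : R) : compact [set z : R[i]^o | rnorm z <= r].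
Proof.
pose h (u : R * R) : R[i]^o := Complex u.1 u.2.
have rnorm_h u v : rnorm (h u - h v) <= `|u.1 - v.1| + `|u.2 - v.2|.
  have -> : h u - h v = real_complex R (u.1 - v.1) + 'i%C * real_complex R (u.2 - v.2).
    apply/eqP; rewrite eq_complex /=.
    by apply/andP; split; apply/eqP; rewrite /=; lra.
  apply: (le_trans (rnormD _ _)); rewrite rnorm_real lerD2l.
  rewrite -scaleCE rnormZ rnorm_real /rnorm normc_def /= expr0n expr1n add0r sqrtr1.
  by rewrite mul1r.
have hc : continuous h.
  move=> u A /rnorm_nbhs[e e0 eA].
  have e2 : 0 < e / 2 by rewrite divr_gt0.
  exists ([set x | `|u.1 - x| < e / 2], [set x | `|u.2 - x| < e / 2]) => /=.
    by split; apply/nbhs_normP; exists (e / 2).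
  move=> [x y] /= [x1 y2]; apply: eA.
  by apply: (le_lt_trans (rnorm_h u (x, y))) => /=; lra.
apply: (@subclosed_compact _ _ (h @` (`[- r, r] `*` `[- r, r]))).
- move=> z zc; rewrite /= leNgt; apply/negP => rz.
  have /zc[w [/= wr zw]] : nbhs z [set w : R[i]^o | rnorm (z - w) < rnorm z - r].
    by apply/rnorm_nbhs; exists (rnorm z - r) => //; rewrite subr_gt0.
  have := rnormD (z - w) w; rewrite subrK; lra.
- apply: continuous_compact; first exact: continuous_subspaceT.
  by apply: compact_setX; exact: segment_compact.
- move=> z /= zr; exists (complex.Re z, complex.Im z); last by case: z zr.
  split; rewrite /= in_itv /=.
    have := Re_le_rnorm z; have := Re_le_rnorm (- z); rewrite rnormN.
    by case: z zr => a b /= *; apply/andP; split; lra.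
  have := Re_le_rnorm ('i%C * z : R[i]^o); have := Re_le_rnorm (- ('i%C * z) : R[i]^o).
  rewrite rnormN -scaleCE rnormZ.
  have -> : rnorm ('i%C : R[i]^o) = 1.
    by rewrite /rnorm normc_def /= expr0n expr1n add0r sqrtr1.
  by case: z zr => a b /= *; apply/andP; split; lra.
Qed.

Lemma ptws_near (I : eqType) (T : topologicalType) (i : I)
    (h : {ptws I -> T}) (A : set T) :
  nbhs (h i) A -> \forall h' \near h, A (h' i).
Proof. exact: (@proj_continuous I (fun=> T) i h A). Qed.

Section Alaoglu.
Variables (R : realType) (E : normedModType R[i]).
Local Notation ball := (set_type (dual_ball (E:=E))).
Implicit Types (f g : ball).

Lemma ball_evaluation_continuous x : continuous (fun f => \val (\val f) x : R[i]^o).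
Proof.
move=> f A /(@dual_evaluation_continuous _ _ x (\val f)).
exact: (@initial_continuous _ _ (set_val : ball -> dual E) f).
Qed.

Lemma ball_nbhs f (A : set ball) :
  nbhs f A -> exists s : seq E, exists2 e : R, 0 < e & forall g,
    (forall x, x \in s -> rnorm (\val (\val f) x - \val (\val g) x) < e) -> A g.
Proof.
move=> [_ [[U oU <-] Uf UA]].
have /dual_nbhs[s [e e0 sU]] : nbhs (\val f) U by exact: open_nbhs_nbhs.
by exists s, e => // g gs; apply: UA; exact: sU.
Qed.

Lemma ball_le f x : rnorm (\val (\val f) x) <= rnorm x.
Proof. by have /dual_ballP := set_mem (valP f). Qed.

(** The ball is covered through the compact product of the discs of radii
    [|x|]: a point of the product is either a functional, or fails to be linear,
    and then so do all nearby points. *)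
Theorem dual_ball_compact : compact [set: ball].
Proof.
pose K := [set h : {ptws E -> R[i]^o} | forall x, rnorm (h x) <= rnorm x].
have Kc : compact K.
  by apply: (@tychonoff E (fun=> R[i]^o) (fun x => [set z | rnorm z <= rnorm x])) => x;
    exact: compact_disc.
apply/compact_near_coveringP => J F P FF cov.
have : \forall i \near F, K `<=` [set h | forall f, \val (\val f) = h -> P i f].
  apply: (iffLR (compact_near_coveringP _) Kc) => h Kh.
  have [hl|/existsNP[a /existsNP[x /existsNP[y hn]]]] := pselect (linear h).
    have [f fh] := @linear_dual _ _ h 1 hl (fun x =>
      eq_ind_r (fun r => rnorm (h x) <= r) (Kh x) (mul1r _)).
    have Bf : f \in dual_ball (E:=E).
      by apply/mem_set/dual_ballP; rewrite fh.
    pose f' : ball := exist _ f Bf.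
    have [[U V] /= [fU FV] UVP] := cov f' I.
    have [s [e e0 sU]] := ball_nbhs fU.
    exists ([set h' | forall x, x \in s -> rnorm (h x - h' x) < e], V); last first.
      move=> [h' i] /= [h's Vi] g gh'.
      by apply: (UVP (g, i)); split=> //; apply: sU => x xs; rewrite /= fh gh' h's.
    split=> //=.
    apply: (@near_seq _ _ (nbhs h) s (fun x h' => rnorm (h x - h' x) < e)) => x _.
    by apply: (@ptws_near _ _ x h [set z | rnorm (h x - z) < e]); apply/rnorm_nbhs; exists e.
  pose D (h' : {ptws E -> R[i]^o}) : R[i]^o := h' (a *: x + y) - (a *: h' x + h' y).
  have ev z : (fun h' : {ptws E -> R[i]^o} => h' z : R[i]^o) @ h --> (h z : R[i]^o).
    by move=> A; exact: ptws_near.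
  have Dc := cvgB (ev (a *: x + y)) (cvgD (@cvgZr _ _ _ _ _ a _ _ (ev x)) (ev y)).
  have D0 : 0 < rnorm (D h).
    rewrite lt_neqAle rnorm_ge0 andbT; apply/eqP => /esym/rnorm_eq0/eqP.
    by rewrite subr_eq0 => /eqP.
  have : nbhs (D h) [set z : R[i]^o | z != 0].
    apply/rnorm_nbhs; exists (rnorm (D h)) => // z.
    by apply: contraTneq => ->; rewrite subr0 ltxx.
  move=> /Dc nD; exists ([set h' | D h' != 0], setT).
    by split=> //; exact: filterT.
  move=> [h' i] /= [+ _] g gh'; rewrite -gh' /D dual_linear.
  by rewrite subrr eqxx.
by apply: filterS => i Ki f _; apply: (Ki (\val (\val f))) => // x; exact: ball_le.
Qed.

End Alaoglu.

(** * The Vietoris topology in terms of the seminorms *)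

Lemma open_vietoris_subbase (X : topologicalType) (i : bool * set X) :
  open i.2 -> open (vietoris_subbase i).
Proof.
move=> oi; exists [set vietoris_subbase i]; last by rewrite bigcup_set1.
move=> _ ->; exists [fset i]%fset; first by move=> j /fset1P ->; exact: mem_set.
by rewrite set_fset1 bigcap_set1.
Qed.

(** A basic open set is a finite intersection of subbasic ones, and filters are
    closed under finite intersections. *)
Lemma vietoris_filter_cvg (X : topologicalType) (Z : Type) (F : set_system Z)
    (h : Z -> closed_subsets X) (K : closed_subsets X) : Filter F ->
  (forall U : set X, open U -> \val K `&` U !=set0 ->
     \forall z \near F, \val (h z) `&` U !=set0) ->
  (forall U : set X, open U -> \val K `<=` U ->
     \forall z \near F, \val (h z) `<=` U) ->
  h @ F --> K.
Proof.
move=> FF hit miss A; rewrite nbhsE => -[_ [[B sB <-] [D BD DK]] BA].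
apply: (@filterS _ _ _ (h @^-1` D)).
  by move=> z Dz; apply: BA; exists D.
have [J sJ JD] := sB _ BD; rewrite -JD preimage_bigcap.
apply: filter_bigI => -[b U] bUJ.
have /set_mem /= oU := sJ _ bUJ.
move: DK; rewrite -JD => /(_ (b, U) bUJ).
by case: b {bUJ}; rewrite /vietoris_subbase /=; [exact: hit|exact: miss].
Qed.

Section GrassmannianTopology.
Variables (R : realType) (E : normedModType R[i]).
Local Notation ball := (set_type (dual_ball (E:=E))).
Implicit Types (W : grassmannian E).

Lemma unit_ball_of_continuous : continuous (@unit_ball_of R E).
Proof. exact: initial_continuous. Qed.

Lemma near_hit W (U : set ball) : open U -> \val (unit_ball_of W) `&` U !=set0 ->
  \forall W' \near W, \val (unit_ball_of W') `&` U !=set0.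
Proof.
move=> oU WU; have : nbhs (unit_ball_of W) (vietoris_subbase (true, U)).
  by apply: open_nbhs_nbhs; split; [exact: open_vietoris_subbase|].
by move=> /unit_ball_of_continuous.
Qed.

Lemma near_miss W (U : set ball) : open U -> \val (unit_ball_of W) `<=` U ->
  \forall W' \near W, \val (unit_ball_of W') `<=` U.
Proof.
move=> oU WU; have : nbhs (unit_ball_of W) (vietoris_subbase (false, U)).
  by apply: open_nbhs_nbhs; split; [exact: open_vietoris_subbase|].
by move=> /unit_ball_of_continuous.
Qed.

Lemma open_evaluation (x : E) (S : set R[i]^o) : open S ->
  open [set f : ball | S (\val (\val f) x)].
Proof.
by move=> oS; have /continuousP := @ball_evaluation_continuous R E x; exact.
Qed.

Lemma rnorm_continuous (V : normedModType R[i]) : continuous (@rnorm R V).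
Proof.
move=> x; apply/cvgrPdist_lt => e e0; apply/rnorm_nbhs; exists e => // y.
have := rnormD (x - y) y; have := rnormD (y - x) x; rewrite !subrK (rnormB y) => *.
by rewrite ltr_norml; apply/andP; split; lra.
Qed.

(** A value of [wnorm W x] is approached from below by an element that the
    unit ball hits, and from above by an inclusion of the unit ball. *)
Lemma wnorm_near W x (e : R) : 0 < e ->
  \forall W' \near W, `|wnorm W x - wnorm W' x| < e.
Proof.
move=> e0.
have oR (A : set R) : open A -> open [set z : R[i]^o | A (rnorm z)].
  by move: A; apply/continuousP; exact: rnorm_continuous.
have lower : \forall W' \near W, wnorm W x - e < wnorm W' x.
  have [f [Wf Bf fx]] := @wnorm_gt _ _ W x (wnorm W x - e) ltac:(lra).
  have o1 := @open_evaluation x _ (oR _ (@open_gt R (wnorm W x - e))).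
  have /(near_hit o1) : \val (unit_ball_of W) `&`
      [set g : ball | wnorm W x - e < rnorm (\val (\val g) x)] !=set0.
    by exists (exist _ f (mem_set Bf)); split.
  apply: filterS => W' [g [/= gW' h]]; apply: (lt_le_trans h).
  by apply: wnorm_ub => //; exact: set_mem (valP g).
have upper : \forall W' \near W, wnorm W' x < wnorm W x + e.
  have o1 := @open_evaluation x _ (oR _ (@open_lt R (wnorm W x + e / 2))).
  have /(near_miss o1) : \val (unit_ball_of W) `<=`
      [set g : ball | rnorm (\val (\val g) x) < wnorm W x + e / 2].
    move=> g /= gW; apply: (@le_lt_trans _ _ (wnorm W x)); last by lra.
    by apply: wnorm_ub => //; exact: set_mem (valP g).
  apply: filterS => W' sub; apply: (@le_lt_trans _ _ (wnorm W x + e / 2)); last by lra.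
  apply: wnorm_le => f W'f Bf; apply/ltW.
  exact: (sub (exist _ f (mem_set Bf))).
near=> W'; rewrite ltr_norml; apply/andP; split.
  by rewrite ltrBrDr addrC ltrBlDr; near: W'.
by rewrite ltrBlDr addrC -ltrBlDr; near: W'.
Unshelve. all: by end_near. Qed.

End GrassmannianTopology.

Section SeminormConvergence.
Variables (R : realType) (E : normedModType R[i]).
Local Notation C := (R[i]^o).
Local Notation ball := (set_type (dual_ball (E:=E))).
Implicit Types (W : grassmannian E).

(** On [E * C^n], the seminorm [wnorm W y + e * \sum_i |c i|] dominates the
    functional [c |-> f (\sum_i c i *: x i)] on the graph of the combination map.
    An extension of it splits [f], on the span of the [x i], into a functional
    bounded by [wnorm W], hence in [W], and a part of size at most [e] at each
    [x i]. *)
Lemma approximate_extension W n (x : 'I_n -> E) (f : dual E) (e : R) : 0 <= e ->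
  (forall c : 'I_n -> R[i], rnorm (\val f (\sum_i c i *: x i)) <=
     wnorm W (\sum_i c i *: x i) + e * \sum_i rnorm (c i : C)) ->
  exists g, [/\ \val W g, dual_ball g &
    forall i, rnorm (\val f (x i) - \val g (x i)) <= e].
Proof.
move=> e0 fW; pose L := (E * 'rV[R[i]]_n)%type.
pose P (u : L) := wnorm W u.1 + e * \sum_i rnorm (u.2 0 i : C).
have PD u v : P (u + v) <= P u + P v.
  rewrite /P addrACA lerD ?wnormD// -mulrDr ler_wpM2l// -big_split ler_sum// => i _.
  by rewrite mxE rnormD.
have PZ (a : C) (u : L) : P ((a : R[i]) *: u) = rnorm a * P u.
  rewrite /P wnormZ mulrDr mulrCA; congr (_ + e * _).
  by rewrite mulr_sumr; apply: eq_bigr => i _; rewrite mxE -scaleCE rnormZ.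
pose T (c : 'rV[R[i]]_n) : E := \sum_i c 0 i *: x i.
have TD a c c' : T (c + a *: c') = T c + a *: T c'.
  rewrite /T scaler_sumr -big_split; apply: eq_bigr => i _.
  by rewrite !mxE scalerDl scalerA.
have T0 : T 0 = 0 by rewrite /T big1// => i _; rewrite mxE scale0r.
pose G : set (L * C) := [set u | exists c, u = ((T c, c), \val f (T c))].
have [|||h [hlin hP hG]] := hahn_banach PD PZ (G := G).
- by exists 0; rewrite T0 dual_app0.
- move=> _ _ a [c ->] [c' ->] /=; exists (c + a *: c').
  by rewrite TD dual_appD dual_appZ.
- by move=> _ [c ->] /=; exact: fW.
have hxP y : rnorm (h (y, 0)) <= wnorm W y.
  apply: (le_trans (hP _)); rewrite /P /= big1 ?mulr0 ?addr0// => i _.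
  by rewrite mxE rnorm0.
have glin : linear (fun y => h (y, 0) : C).
  move=> a y z; rewrite -hlin; congr h.
  by apply: injective_projections; rewrite //= scaler0 addr0.
have [g gh] := @linear_dual _ _ _ 1 glin (fun y => le_trans (hxP y)
  (eq_ind_r (fun r => wnorm W y <= r) (wnorm_le_rnorm W y) (mul1r _))).
exists g; split.
- by apply: grassmannian_of_le_wnorm => y; rewrite gh.
- by apply/dual_ballP => y; rewrite gh (le_trans (hxP y))// wnorm_le_rnorm.
move=> i; pose c : 'rV[R[i]]_n := delta_mx 0 i.
have Tc : T c = x i.
  rewrite /T (bigD1 i)//= mxE !eqxx scale1r big1 ?addr0// => j ji.
  by rewrite mxE (negbTE ji) andbF scale0r.
have := hG _ (ex_intro _ c erefl) => /=; rewrite Tc => <-.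
rewrite gh; have -> : (x i, c) = 1 *: (x i, 0) + (0, c) :> L.
  by apply: injective_projections; rewrite /= scale1r ?addr0 ?add0r.
rewrite hlin scale1r addrAC subrr add0r; apply: (le_trans (hP _)).
rewrite /P /= (iffRL (wnorm_eq0 W 0)) ?add0r; last first.
  by move=> k _; exact: dual_app0.
rewrite (bigD1 i)//= mxE !eqxx big1 => [|j ji]; last first.
  by rewrite mxE (negbTE ji) andbF rnorm0.
by rewrite addr0 /rnorm normr1 mulr1.
Qed.

Lemma combination_near n (x : 'I_n -> E) (c : {ptws 'I_n -> C}) (r : R) : 0 < r ->
  \forall c' \near c,
    rnorm (\sum_i (c i : R[i]) *: x i - \sum_i (c' i : R[i]) *: x i) < r.
Proof.
move=> r0; pose b := r / n.+1%:R.
have b0 : 0 < b by rewrite divr_gt0.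
have : \forall c' \near c, forall i, i \in enum 'I_n ->
    rnorm (c i - c' i) * rnorm (x i) <= b.
  apply: (@near_seq _ _ (nbhs c) _
    (fun i (c' : {ptws 'I_n -> C}) => rnorm (c i - c' i) * rnorm (x i) <= b)) => i _.
  have x0 : 0 < rnorm (x i) + 1 by rewrite ltr_wpDl ?rnorm_ge0.
  have h : nbhs (c i) [set z : C | rnorm (c i - z) < b / (rnorm (x i) + 1)].
    by apply/rnorm_nbhs; exists (b / (rnorm (x i) + 1)); rewrite ?divr_gt0.
  have : \forall c' \near c, rnorm (c i - c' i) < b / (rnorm (x i) + 1).
    exact: (ptws_near h).
  apply: (@filterS _ _ (nbhs_filter c)) => c'.
  rewrite ltr_pdivlMr// => /ltW; apply: le_trans.
  by rewrite ler_wpM2l ?rnorm_ge0// lerDl.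
apply: (@filterS _ _ (nbhs_filter c)) => c' cc'; rewrite -sumrB.
apply: (le_lt_trans (rnorm_sum _)); apply: (@le_lt_trans _ _ (n%:R * b)).
  have -> : n%:R * b = \sum_(i < n) b by rewrite sumr_const card_ord mulr_natl.
  apply: ler_sum => i _; rewrite -scalerBl (@rnormZ R E (c i - c' i)).
  by apply: cc'; rewrite mem_enum.
by rewrite /b mulrCA gtr_pMr// ltr_pdivrMr// mul1r ltr_nat.
Qed.

Variables (W : grassmannian E) (F : set_system (grassmannian E)).
Hypothesis FF : Filter F.
Hypothesis FW : forall x (e : R), 0 < e ->
  \forall W' \near F, `|wnorm W x - wnorm W' x| < e.

(** Each point of the ball outside [U] is separated from [W] by a point [x]
    where [wnorm W] vanishes; compactness leaves finitely many of them. *)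
Lemma miss_of_wnorm (U : set ball) : open U -> \val (unit_ball_of W) `<=` U ->
  \forall W' \near F, \val (unit_ball_of W') `<=` U.
Proof.
move=> oU WU.
have : \forall W' \near F, [set: ball] `<=` [set f | \val W' (\val f) -> U f].
  apply: (iffLR (compact_near_coveringP _) (@dual_ball_compact R E)) => f _.
  have [Uf|nUf] := pselect (U f).
    exists (U, setT); last by move=> [g W'] [/= Ug _] _.
    by split; [apply: open_nbhs_nbhs; split|exact: filterT].
  have [x [xW fx]] : exists x, preannihilator (\val W) x /\ \val (\val f) x <> 0.
    apply: contrapT => nx; apply: nUf; apply: WU; apply: bipolar.
    - exact: grassmannian_submod.
    - exact: grassmannian_closed.
    by move=> x xW; apply: contrapT => fx; apply: nx; exists x.
  pose d := rnorm (\val (\val f) x) / 2.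
  have d0 : 0 < d.
    rewrite divr_gt0// lt_neqAle rnorm_ge0 andbT; apply/eqP => h.
    by apply: fx; exact: rnorm_eq0.
  exists ([set g : ball | rnorm (\val (\val f) x - \val (\val g) x) < d],
    [set W' | `|wnorm W x - wnorm W' x| < d]).
    split; last exact: FW.
    apply: (@ball_evaluation_continuous _ _ x f [set z | rnorm (\val (\val f) x - z) < d]).
    by apply/rnorm_nbhs; exists d.
  move=> [g W'] /= [fg WW'] W'g; exfalso.
  have := wnorm_ub x W'g (set_mem (valP g)).
  move: WW'; rewrite (iffRL (wnorm_eq0 W x) xW) sub0r normrN ger0_norm ?wnorm_ge0//.
  have := rnormD (\val (\val f) x - \val (\val g) x) (\val (\val g) x).
  rewrite subrK; move: fg; rewrite /d; lra.
by apply: filterS => W' W'U f fW'; exact: W'U.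
Qed.

(** By homogeneity, the bound that [approximate_extension] asks for needs only
    be checked for coefficients in a polydisc, which is compact. *)
Lemma hit_of_wnorm (U : set ball) : open U -> \val (unit_ball_of W) `&` U !=set0 ->
  \forall W' \near F, \val (unit_ball_of W') `&` U !=set0.
Proof.
move=> oU [f [Wf Uf]].
have [s [e e0 sU]] := ball_nbhs (open_nbhs_nbhs (conj oU Uf)).
pose n := size s; pose x (i : 'I_n) := s`_i; pose d := e / 2.
have d0 : 0 < d by rewrite divr_gt0.
pose X := {ptws 'I_n -> C}; pose T (c : X) : E := \sum_i (c i : R[i]) *: x i.
pose K : set X := [set c | forall i, rnorm (c i) <= 1].
have Kc : compact K.
  by apply: (@tychonoff 'I_n (fun=> C) (fun=> [set z | rnorm z <= 1])) => i;
    exact: compact_disc.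
have Tc (c : X) (r : R) : 0 < r -> \forall c' \near c, rnorm (T c - T c') < r.
  exact: combination_near.
have : \forall W' \near F, K `<=` [set c |
    rnorm (\val (\val f) (T c)) <= wnorm W' (T c) + d].
  apply: (iffLR (compact_near_coveringP _) Kc) => c _.
  exists ([set c' | rnorm (T c - T c') < d / 3],
    [set W' | `|wnorm W (T c) - wnorm W' (T c)| < d / 3]).
    split; first by apply: Tc; rewrite divr_gt0.
    by apply: FW; rewrite divr_gt0.
  move=> [c' W'] /= [cc' WW'].
  have h1 := wnorm_ub (T c) Wf (set_mem (valP f)).
  have h2 := rnormD (\val (\val f) (T c' - T c)) (\val (\val f) (T c)).
  rewrite -dual_appD subrK in h2.
  have h3 := ball_le f (T c' - T c); rewrite (rnormB (T c')) in h3.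
  have := wnorm_lipschitz W' (T c) (T c').
  by move: WW'; rewrite ltr_norml => /andP[]; lra.
apply: filterS => W' KW'.
have [|c|g [W'g Bg fg]] := @approximate_extension W' n x (\val f) d; first exact: ltW.
  set S : R := \sum_i rnorm (c i : C).
  have S0 : 0 <= S by rewrite sumr_ge0// => i _; exact: rnorm_ge0.
  have [Sz|Sn] := eqVneq S 0.
    rewrite Sz mulr0 addr0 (_ : \sum_i _ = 0) ?dual_app0 ?rnorm0 ?wnorm_ge0//.
    apply: big1 => i _; rewrite (_ : c i = 0) ?scale0r//.
    apply: (@rnorm_eq0 _ C).
    have /eqP := Sz; rewrite psumr_eq0 => [/allP/(_ i)|j _]; last exact: rnorm_ge0.
    by rewrite mem_index_enum => /(_ isT)/eqP.
  have {Sn}S0 : 0 < S by rewrite lt_neqAle eq_sym Sn.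
  pose c' : X := fun i => real_complex R S^-1 * c i.
  have Tc' : T c' = real_complex R S^-1 *: \sum_i c i *: x i.
    by rewrite /T scaler_sumr; apply: eq_bigr => i _; rewrite scalerA.
  have /KW' /= : K c'.
    move=> i; rewrite /c' -scaleCE rnormZ rnorm_real ger0_norm ?invr_ge0 ?(ltW S0)//.
    rewrite ler_pdivrMl// mulr1 /S (bigD1 i)//= lerDl sumr_ge0// => j _.
    exact: rnorm_ge0.
  rewrite Tc' dual_appZ wnormZ rnormZ rnorm_real ger0_norm ?invr_ge0 ?(ltW S0)//.
  by rewrite ler_pdivrMl// mulrDr mulrA mulfV ?gt_eqF// mul1r (mulrC S).
exists (exist _ g (mem_set Bg)); split=> //; apply: sU => y ys.
have ny : (index y s < n)%N by rewrite index_mem.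
have := fg (Ordinal ny); rewrite /x /= nth_index// => /le_lt_trans; apply.
by rewrite /d; lra.
Qed.

Lemma grassmannian_cvg : F --> W.
Proof.
have Fu : @unit_ball_of R E @ F --> unit_ball_of W.
  by apply: vietoris_filter_cvg; [exact: hit_of_wnorm|exact: miss_of_wnorm].
move=> A [_ [[U oU <-] UW UA]]; have : nbhs (unit_ball_of W) U.
  exact: open_nbhs_nbhs.
move=> /Fu FU; exact: (filterS UA FU).
Qed.

End SeminormConvergence.

(** * Seminorms arising from weak-* closed subspaces *)

Section QuotientSeminorm.
Variables (R : realType) (E : completeNormedModType R[i]).
Variable P : E -> R.
Hypothesis PD : forall x y, P (x + y) <= P x + P y.
Hypothesis PZ : forall (a : R[i]^o) x, P ((a : R[i]) *: x) = rnorm a * P x.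
Hypothesis PN : forall x, P x <= rnorm x.
Hypothesis Papprox : forall x (e : R), 0 < e ->
  exists y, rnorm (x - y) < P x + e /\ P y < e.

Lemma seminorm0 : P 0 = 0.
Proof. by rewrite -(scale0r 0) (PZ 0) rnorm0 mul0r. Qed.

Lemma seminormB x y : P (x - y) = P (y - x).
Proof. by rewrite -opprB -scaleN1r (PZ (-1)) /rnorm normrN1 mul1r. Qed.

Lemma seminorm_ge0 x : 0 <= P x.
Proof.
have := PD x (- x); rewrite subrr seminorm0.
by have := seminormB 0 x; rewrite sub0r subr0 => ->; lra.
Qed.

Lemma seminorm_lipschitz x y : P x <= P y + rnorm (x - y).
Proof.
rewrite -{1}[x](subrK y) addrC; apply: (le_trans (PD _ _)).
by rewrite lerD2l PN.
Qed.

(** The approximate zeros of [P] are corrected repeatedly: starting from [x],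
    the step from [y n] to [y n.+1] has length at most [P (y n)] plus a
    summable error, and [P (y n)] is itself summable after the first step. *)
Lemma seminorm_exact_zero x (e : R) : 0 < e ->
  exists y, P y = 0 /\ rnorm (x - y) < P x + e.
Proof.
move=> e0.
have /choice[nx nxP] : forall u : E * R, exists y, 0 < u.2 ->
    rnorm (u.1 - y) < P u.1 + u.2 /\ P y < u.2.
  move=> [z r]; have [r0|r0] := boolP (0 < r); last by exists 0.
  by have [y hy] := Papprox z r0; exists y.
(* with errors [e / 8], [e / 16], ... all the steps add up to less than [P x + e] *)
pose d n : R := e / 8 / 2 ^+ n.
have d0 n : 0 < d n by rewrite !divr_gt0 ?exprn_gt0.
have dS n : d n = d n.+1 + d n.+1 by rewrite /d exprS; field; rewrite expf_neq0.
pose y := fix y n := if n is m.+1 then nx (y m, d m) else x.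
have yP n : rnorm (y n - y n.+1) < P (y n) + d n /\ P (y n.+1) < d n.
  exact: (nxP (y n, d n) (d0 n)).
(* for [n > 0] the step from [y n] to [y n.+1] is at most
   [d n.-1 + d n = 3 * d n], which is [6 * (d n - d n.+1)] *)
have ydist m k : rnorm (y m.+1 - y (m.+1 + k)%N) <= 6 * (d m.+1 - d (m.+1 + k)%N).
  elim: k => [|k IH]; first by rewrite addn0 !subrr rnorm0 mulr0.
  have := rnormD (y m.+1 - y (m.+1 + k)%N) (y (m.+1 + k)%N - y (m.+1 + k.+1)%N).
  rewrite addrA subrK addnS.
  have [h1 _] := yP (m.+1 + k)%N; have [_ h2] := yP (m + k)%N.
  move: h1 h2 IH; rewrite !addSn.
  have := dS (m + k)%N; have := dS (m + k).+1.
  lra.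
have d_small (r : R) : 0 < r -> exists n, d n < r.
  move=> r0; pose n := Num.truncn (r^-1 * (e / 8)); exists n.+1.
  rewrite /d ltr_pdivrMr ?exprn_gt0// -ltr_pdivrMl//.
  apply: (lt_trans (truncnS_gt _)); rewrite -natrX ltr_nat.
  exact: ltn_expl.
have cy : cvg (y @ \oo).
  apply/cauchy_cvgP/cauchy_ballP => r r0; rewrite near_simpl.
  have rE : r = real_complex R (complex.Re r) by rewrite RRe_real// gtr0_real.
  have r0' : 0 < complex.Re r / 12 by rewrite divr_gt0//; move: r0; rewrite rE ltcR.
  have [N hN] := d_small _ r0'.
  exists ([set n | (N.+1 <= n)%N], [set n | (N.+1 <= n)%N]).
    by split; exists N.+1.
  move=> [m n] [/= Nm Nn]; rewrite -ball_normE /= rnormE rE ltcR.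
  have hb k : (N.+1 <= k)%N -> rnorm (y N.+1 - y k) < complex.Re r / 2.
    move=> Nk; have := ydist N (k - N.+1)%N; rewrite subnKC//.
    have := dS N; have := d0 k; have := d0 N.+1; lra.
  have := rnormD (y m - y N.+1) (y N.+1 - y n); rewrite addrA subrK.
  by have := hb _ Nm; have := hb _ Nn; rewrite (rnormB (y m) (y N.+1)); lra.
pose l := lim (y @ \oo).
have yl (r : R) : 0 < r -> exists N, forall n, (N <= n)%N -> rnorm (l - y n) < r.
  move=> r0; have : nbhs l [set z | rnorm (l - z) < r] by apply/rnorm_nbhs; exists r.
  by move=> /cy[N _ hN]; exists N => n /hN.
exists l; split.
  apply/le_anti; rewrite seminorm_ge0 andbT; apply/ler_addgt0Pl => r r0; rewrite addr0.
  have r2 : 0 < r / 2 by rewrite divr_gt0.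
  have [M hM] := yl _ r2; have [N hN] := d_small _ r2.
  have [_ h] := yP (N + M)%N.
  have := hM (N + M).+1 (leqW (leq_addl _ _)).
  have := seminorm_lipschitz l (y (N + M).+1).
  have dNM : d (N + M)%N <= d N.
    by elim: M {hM h} => [|M IH]; rewrite ?addn0// addnS; have := dS (N + M)%N;
      have := d0 (N + M).+1; lra.
  by lra.
have e8 : 0 < e / 8 by rewrite divr_gt0.
have [M hM] := yl _ e8.
have := hM M.+1 (leqnSn _).
have [h0 _] := yP 0%N; have := ydist 0%N M; rewrite add1n.
have := rnormD (x - y 1%N) (y 1%N - y M.+1); rewrite addrA subrK.
have := rnormD (x - y M.+1) (y M.+1 - l); rewrite addrA subrK (rnormB (y M.+1) l).
have : d 0%N = e / 8 by rewrite /d expr0 divr1.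
have := dS 0%N; have := d0 M.+1; move: h0 => /=; lra.
Qed.

Let annihilator : set (dual E) :=
  [set f | forall x, P x = 0 -> \val f x = 0].

Let annihilator_submod : submod_closed [in annihilator].
Proof.
split; first exact: mem_set.
move=> a f g /set_mem fP /set_mem gP; apply/mem_set => x x0.
by rewrite dualD_app dualZ_app fP// gP// scaler0 addr0.
Qed.

Let annihilator_closed : closed annihilator.
Proof.
move=> f fcl x x0; apply: contrapT => fx.
have fx0 : 0 < rnorm (\val f x).
  by rewrite lt_neqAle rnorm_ge0 andbT; apply/eqP => /esym/rnorm_eq0.
have : nbhs f [set g : dual E | rnorm (\val f x - \val g x) < rnorm (\val f x)].
  apply: (@dual_evaluation_continuous _ _ x f
    [set z | rnorm (\val f x - z) < rnorm (\val f x)]).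
  by apply/rnorm_nbhs; exists (rnorm (\val f x)).
by move=> /fcl[g [/(_ x x0) gx]] /=; rewrite gx subr0 ltxx.
Qed.

(** [P] is the distance to its kernel by [seminorm_exact_zero], which bounds
    the annihilator of the kernel by [P]; the Hahn-Banach theorem shows that the
    bound is attained. *)
Lemma seminorm_of_subspace : exists W : grassmannian E, forall x, wnorm W x = P x.
Proof.
pose W : grassmannian E :=
  exist _ annihilator (mem_set (conj annihilator_submod annihilator_closed)).
exists W => x; apply/le_anti/andP; split.
  apply: wnorm_le => f Wf /dual_ballP fB; apply/ler_addgt0Pl => e e0.
  have [y [y0 xy]] := seminorm_exact_zero x e0.
  have := fB (x - y); rewrite dual_appB (Wf y y0) subr0.
  by move=> /le_trans; apply; rewrite [e + _]addrC ltW.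
pose G : set (E * R[i]^o) :=
  [set u | exists a : R[i], u = (a *: x, a * real_complex R (P x))].
have [|||g [glin gP gG]] := hahn_banach PD PZ (G := G).
- by exists 0; rewrite scale0r mul0r.
- move=> _ _ b [a ->] [a' ->]; exists (a + b * a').
  by rewrite /= scalerDl mulrDl scalerA scaleCE mulrA.
- move=> _ [a ->] /=.
  by rewrite PZ -scaleCE rnormZ rnorm_real ger0_norm ?seminorm_ge0.
have [f fg] := @linear_dual _ _ g 1 glin (fun y => le_trans (gP y)
  (eq_ind_r (fun r => P y <= r) (PN y) (mul1r _))).
have Wf : \val W f.
  move=> y y0; rewrite fg; apply: rnorm_eq0.
  by apply/le_anti; rewrite rnorm_ge0 andbT -y0.
have Bf : dual_ball f.
  by apply/dual_ballP => y; rewrite fg (le_trans (gP y)).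
have := wnorm_ub x Wf Bf; rewrite fg (gG (x, real_complex R (P x))).
  by rewrite rnorm_real ger0_norm ?seminorm_ge0.
by exists 1; rewrite scale1r mul1r.
Qed.

End QuotientSeminorm.

(** * The Grassmannian is Polish *)

Lemma separable_dense_sequence (R : realType) (E : normedModType R[i]) :
  separable E -> exists q : nat -> E,
    forall x (e : R), 0 < e -> exists n, rnorm (x - q n) < e.
Proof.
move=> [D /countable_injP[c cinj] Ddense].
exists (fun n => xget 0 [set x | D x /\ c x = n]) => x e e0.
have nx : nbhs x [set y | rnorm (x - y) < e] by apply/rnorm_nbhs; exists e.
move: nx; rewrite nbhsE => -[U [oU Ux] Ue].
have [y [Uy Dy]] := Ddense U (ex_intro _ x Ux) oU.
exists (c y); have -> : xget 0 [set x | D x /\ c x = c y] = y; last exact: Ue.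
have [Dz cz] := xgetPex 0 (ex_intro [set x | D x /\ c x = c y] y (conj Dy erefl)).
by apply: cinj => //; rewrite inE.
Qed.

Section Coordinates.
Variables (R : realType) (E : completeNormedModType R[i]) (q : nat -> E).
Hypothesis qdense : forall x (e : R), 0 < e -> exists n, rnorm (x - q n) < e.
Implicit Types (W : grassmannian E) (p : nat -> R).

Let phi W n : R := wnorm W (q n).

Let phi_inj W W' : (forall n, phi W n = phi W' n) -> W = W'.
Proof.
move=> WW'; apply: wnorm_inj => x; apply/eqP; rewrite -subr_eq0 -normr_le0.
apply/ler_addgt0Pl => e e0; rewrite addr0.
have e2 : 0 < e / 2 by rewrite divr_gt0.
have [n xn] := qdense x e2; have := WW' n; rewrite /phi => WW'n.
have := wnorm_dist W x (q n); have := wnorm_dist W' (q n) x.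
rewrite (rnormB (q n)) WW'n => h1 h2.
by apply: (le_trans (ler_distD (wnorm W' (q n)) _ _)); lra.
Qed.

Let phi_ball_filter p : Filter
  (filter_from [set e : R | 0 < e] (fun e => [set W | pdist (phi W) p < e])).
Proof.
apply: filter_from_filter; first by exists 1 => /=.
move=> a b a0 b0; exists (Num.min a b); first by rewrite /= lt_min a0.
by move=> W /=; rewrite lt_min => /andP[].
Qed.

Let phi_compat : compatible_metric (fun W W' => pdist (phi W) (phi W')).
Proof.
apply/(compatible_metricP (d := fun W W' => pdist (phi W) (phi W'))).
- by move=> W; apply/(pdist_eq0 0%N).
- by move=> W' W W''; exact: (pdist_triangle 0%N).
move=> W A; split=> [WA|[e e0 eA]].
  have [|e e0 eA] := @grassmannian_cvg R E W _ (phi_ball_filter (phi W)) _ A WA;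
    last by exists e => // W'; rewrite /= pdistC; exact: eA.
  move=> x e e0; have e3 : 0 < e / 3 by rewrite divr_gt0.
  have [n xn] := qdense x e3.
  have [b b0 hb] := pdist_coord 0%N n e3.
  exists b => // W' /= /hb; rewrite /phi distrC => h.
  have := wnorm_dist W x (q n); have := wnorm_dist W' (q n) x.
  rewrite (rnormB (q n)) => h1 h2.
  apply: (le_lt_trans (ler_distD (wnorm W (q n)) _ _)).
  by have := ler_distD (wnorm W' (q n)) (wnorm W (q n)) (wnorm W' x); lra.
have [s [b b0 small]] := @pdist_small R nat 0%N _ e0.
have : \forall W' \near W, forall n, n \in s -> `|phi W n - phi W' n| < b.
  apply: (@near_seq _ _ (nbhs W) s (fun n W' => `|phi W n - phi W' n| < b)) => n _.
  exact: wnorm_near.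
by apply: (@filterS _ _ (nbhs_filter W)) => W' /small/eA.
Qed.

(** The instances at [q n] and [1 / k.+1] of the property that characterizes
    the seminorms which are distances to their kernels. *)
Let quotient_condition (nk : nat * nat) : set (nat -> R) :=
  [set p | exists j, rnorm (q nk.1 - q j) < p nk.1 + nk.2.+1%:R^-1 /\
                     p j < nk.2.+1%:R^-1].

Let quotient_condition_open nk p : quotient_condition nk p ->
  exists2 e : R, 0 < e & forall p', pdist p p' < e -> quotient_condition nk p'.
Proof.
case: nk => n k [j /= [h1 h2]]; set r := k.+1%:R^-1 in h1 h2.
have r1 : 0 < p n + r - rnorm (q n - q j) by rewrite subr_gt0.
have r2 : 0 < r - p j by rewrite subr_gt0.
have [a a0 ha] := pdist_coord 0%N n r1; have [b b0 hb] := pdist_coord 0%N j r2.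
exists (Num.min a b); first by rewrite lt_min a0.
move=> p'; rewrite lt_min => /andP[/ha + /hb +]; rewrite !ltr_norml.
by move=> /andP[_ ?] /andP[? _]; exists j => /=; rewrite -/r; split; lra.
Qed.

Let phi_quotient_condition W nk : quotient_condition nk (phi W).
Proof.
case: nk => n k; have r0 : 0 < (k.+1%:R^-1 : R) by rewrite invr_gt0 ltr0n.
rewrite /quotient_condition /phi /=; set r := k.+1%:R^-1 in r0 *.
have r2 : 0 < r / 2 by rewrite divr_gt0.
have [y [y0 hy]] := wnorm_approx W (q n) r2.
have [j hj] := qdense y r2; exists j; split.
  by have := rnormD (q n - y) (y - q j); rewrite addrA subrK; lra.
have := wnorm_lipschitz W (q j) y; rewrite y0 (rnormB (q j)); lra.
Qed.

Section Limit.
Variable p : nat -> R.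
Hypothesis pcl : forall e : R, 0 < e -> exists W, pdist (phi W) p < e.
Hypothesis pquot : forall nk, quotient_condition nk p.

(** McShane's extension of [p] to a 1-Lipschitz function on [E]; it agrees with
    the pointwise limit of seminorms close to [p], and inherits from them the
    properties of a seminorm. *)
Let P x : R := inf [set p n + rnorm (x - q n) | n in setT].

Let near_p := filter_from [set e : R | 0 < e]
  (fun e => [set W | pdist (phi W) p < e]).

Let near_p_filter : ProperFilter near_p.
Proof.
split; last exact: phi_ball_filter.
by move=> [e /= /pcl[W We] eA]; exact: (eA W We).
Qed.

Let near_p_I (A B : set (grassmannian E)) :
  near_p A -> near_p B -> near_p (A `&` B).
Proof. by move=> FA FB; exact: (@filterI _ _ (phi_ball_filter p)). Qed.

Let near_p_ex (A : set (grassmannian E)) : near_p A -> exists W, A W.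
Proof. exact: (@filter_ex _ _ near_p_filter). Qed.

Let near_p_coord n (e : R) : 0 < e ->
  \forall W \near near_p, `|wnorm W (q n) - p n| < e.
Proof.
move=> e0; have [b b0 hb] := pdist_coord 0%N n e0.
by exists b => // W /= /hb.
Qed.

Let p_lipschitz n m : p n <= p m + rnorm (q n - q m).
Proof.
apply/ler_addgt0Pl => e e0; have e2 : 0 < e / 2 by rewrite divr_gt0.
have /near_p_ex[W [h1 h2]] := near_p_I (near_p_coord n e2) (near_p_coord m e2).
move: h1 h2; rewrite !ltr_norml => /andP[h1 h2] /andP[h3 h4].
by have := wnorm_lipschitz W (q n) (q m); lra.
Qed.

Let P_lbound x n :
  lbound [set p m + rnorm (x - q m) | m in setT] (p n - rnorm (x - q n)).
Proof.
move=> _ [m _ <-]; have := p_lipschitz n m.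
have := rnormD (q n - x) (x - q m); rewrite addrA subrK (rnormB (q n) x); lra.
Qed.

Let P_lower x n : p n - rnorm (x - q n) <= P x.
Proof.
apply: lb_le_inf; last exact: P_lbound.
by exists (p 0%N + rnorm (x - q 0%N)), 0%N.
Qed.

Let P_upper x n : P x <= p n + rnorm (x - q n).
Proof.
by apply: ge_inf; [exists (p 0%N - rnorm (x - q 0%N)); exact: P_lbound|exists n].
Qed.

Let P_q n : P (q n) = p n.
Proof.
have := P_lower (q n) n; have := P_upper (q n) n.
by rewrite subrr rnorm0 subr0 addr0 => h1 h2; apply/le_anti; rewrite h1.
Qed.

Let near_p_P x (e : R) : 0 < e -> \forall W \near near_p, `|wnorm W x - P x| < e.
Proof.
move=> e0; have e3 : 0 < e / 3 by rewrite divr_gt0.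
have [n xn] := qdense x e3.
have := near_p_coord n e3; apply: (@filterS _ _ (phi_ball_filter p)) => W.
have := wnorm_dist W x (q n); have := P_lower x n; have := P_upper x n.
by rewrite ltr_norml ler_norml ltr_norml => h1 h2 /andP[h3 h4] /andP[h5 h6];
  apply/andP; split; lra.
Qed.

Let PD x y : P (x + y) <= P x + P y.
Proof.
apply/ler_addgt0Pl => e e0; have e3 : 0 < e / 3 by rewrite divr_gt0.
have /near_p_ex[W [h1 [h2 h3]]] := near_p_I (near_p_P (x + y) e3)
  (near_p_I (near_p_P x e3) (near_p_P y e3)).
move: h1 h2 h3; rewrite !ltr_norml => /andP[? ?] /andP[? ?] /andP[? ?].
by have := wnormD W x y; lra.
Qed.

Let PZ (a : R[i]^o) x : P ((a : R[i]) *: x) = rnorm a * P x.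
Proof.
apply/eqP; rewrite -subr_eq0 -normr_le0; apply/ler_addgt0Pl => e e0; rewrite addr0.
have e2 : 0 < e / 2 by rewrite divr_gt0.
have a1 : 0 < rnorm a + 1 by rewrite ltr_wpDl ?rnorm_ge0.
have e3 : 0 < e / 2 / (rnorm a + 1) by rewrite divr_gt0.
have /near_p_ex[W [h1 h2]] := near_p_I (near_p_P ((a : R[i]) *: x) e2) (near_p_P x e3).
apply: (le_trans (ler_distD (wnorm W ((a : R[i]) *: x)) _ _)).
rewrite [X in _ + X]distrC {2}wnormZ -mulrBr normrM ger0_norm ?rnorm_ge0//.
have : rnorm a * `|wnorm W x - P x| <= e / 2.
  move: h2; rewrite ltr_pdivlMr// mulrC => /ltW; apply: le_trans.
  by rewrite ler_wpM2r// lerDl.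
by move: h1; rewrite distrC => h1 h3; rewrite [X in _ * X]distrC; lra.
Qed.

Let PN x : P x <= rnorm x.
Proof.
apply/ler_addgt0Pl => e e0; have /near_p_ex[W] := near_p_P x e0.
by rewrite ltr_norml => /andP[? ?]; have := wnorm_le_rnorm W x; lra.
Qed.

Let P_approx x (e : R) : 0 < e -> exists y, rnorm (x - y) < P x + e /\ P y < e.
Proof.
move=> e0; have e4 : 0 < e / 4 by rewrite divr_gt0.
have [n xn] := qdense x e4.
have [k ke] : exists k, (k.+1%:R^-1 : R) < e / 4.
  exists (Num.truncn (e / 4)^-1).
  by rewrite -[ltRHS]invrK ltf_pV2 ?posrE ?ltr0n ?invr_gt0// truncnS_gt.
have [j [h1 h2]] := pquot (n, k).
have {}h1 : rnorm (q n - q j) < p n + e / 4 by apply: (lt_trans h1); rewrite ltrD2l.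
have {}h2 : p j < e / 4 := lt_trans h2 ke.
exists (q j); rewrite P_q; split; last by lra.
have := rnormD (x - q n) (q n - q j); rewrite addrA subrK.
by have := P_lower x n; lra.
Qed.

Lemma limit_in_image : exists W, forall n, phi W n = p n.
Proof.
have [W WP] := seminorm_of_subspace PD PZ PN P_approx.
by exists W => n; rewrite /phi WP P_q.
Qed.

End Limit.

Lemma grassmannian_polish : polish R (grassmannian E).
Proof.
exact: (polish_of_Gdelta_image 0%N phi_inj phi_compat quotient_condition_open
  (fun W nk => phi_quotient_condition W nk) limit_in_image).
Qed.

End Coordinates.

Theorem corollary4p11 (R : realType) (E : completeNormedModType R[i])
    (sepE : separable E) :
  polish R (grassmannian E).
Proof.
have [q qdense] := separable_dense_sequence sepE.
exact: grassmannian_polish qdense.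
Qed.
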